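(* Consider the Best-of-two on the stochastic block model $G(2n,p,q)$, where $p=p(n)=\omega(\log n/n)$ and $r:=q/p$ is a constant. (i) If $r>\sqrt5-2$, then $G(2n,p,q)$ w.h.p. satisfies the following property: there exist two positive constants $C,C'>0$ such that for all $A\subseteq V$ with $\bigl||A|-|V\setminus A|\bigr|=\Omega(n)$, $$\Pr\left[T_{\mathrm{cons}}(A)\le C\left(\log\log n+\frac{\log n}{\log(np)}\right)\right]\ge 1-O(n^{-C'}).$$ (ii) If $r<\sqrt5-2$, then $G(2n,p,q)$ w.h.p. satisfies the following property: there exist a set $A\subseteq V$ with $\bigl||A|-|V\setminus A|\bigr|=\Omega(n)$ and two positive constants $C,C'>0$ such that $$\Pr\left[T_{\mathrm{cons}}(A)\ge \exp(Cn)\right]\ge 1-O(n^{-C'}).$$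
   Context: Stochastic block model: for $n\in\mathbb N$ and $p,q\in[0,1]$ with $q\le p$, $G(2n,p,q)$ is the random graph on $V=V_1\cup V_2$, $|V_1|=|V_2|=n$, $V_1\cap V_2=\emptyset$, in which each pair of distinct vertices $u\in V_i$, $v\in V_j$ forms an edge independently with probability $p$ if $i=j$ and $q$ if $i\ne j$. Here $p=p(n)$, $q=q(n)$. Best-of-two: each vertex of a graph $G=(V,E)$ holds an opinion in $\{1,2\}$. In each synchronous discrete step, every vertex independently samples two uniformly random neighbors (with replacement) and, if both hold the same opinion, adopts it; otherwise it keeps its own opinion. If $A$ is the set of vertices with opinion 1, $A'$ denotes the set of vertices with opinion 1 after one step. The graph is generated first and then kept fixed; then an initial set $A^{(0)}=A$ is chosen and $A^{(t+1)}=(A^{(t)})'$. The consensus time is $T_{\mathrm{cons}}(A)=\min\{t\ge0: A^{(t)}\in\{\emptyset,V\},\ A^{(0)}=A\}$ ($\infty$ if there is no such $t$). In the displayed inequalities $\Pr$ is over the voting process on the fixed graph; ''w.h.p.'' there refers to the random graph. Asymptotics are as $n\to\infty$. ''W.h.p.'' means with probability at least $1-n^{-c}$ for some constant $c>0$. ''Constant'' means independent of $n$. A condition $\bigl||A|-|V\setminus A|\bigr|=\Omega(n)$ means $\bigl||A|-|V\setminus A|\bigr|\ge \kappa n$ for a constant $\kappa>0$; in (i) $\kappa$ is an arbitrary fixed constant (and $C,C'$ and the hidden constants may depend on it), in (ii) such a constant $\kappa$ exists. The logarithm is natural. *)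

(* Defs.v *)
From HB Require Import structures.
From mathcomp Require Import all_boot all_order all_algebra.
From mathcomp Require Import all_classical all_reals all_analysis.

Set Implicit Arguments.
Unset Strict Implicit.
Unset Printing Implicit Defensive.

Import Order.TTheory GRing.Theory Num.Theory.
Import numFieldNormedType.Exports.

Local Open Scope classical_set_scope.
Local Open Scope ring_scope.

(* A simple graph on V is given by its edge set E, a set of two-element
   subsets of V. *)
Definition vpairs (V : finType) : {set {set V}} := [set e : {set V} | #|e| == 2%N].

Definition nbrs (V : finType) (E : {set {set V}}) (v : V) : {set V} :=
  [set u | (u != v) && ([set u; v]%SET \in E)].

(* The 2n vertices; the blocks V_1 and V_2 are the fibres of the first
   projection. *)
Notation sbm_vertex n := (bool * 'I_n)%type.

Definition block (n : nat) (i : bool) : {set sbm_vertex n} := [set v | v.1 == i].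

Definition edge_prob (R : realType) (n : nat) (p q : R)
    (e : {set sbm_vertex n}) : R :=
  if [exists i, e \subset block n i] then p else q.

(* The probability that G(2n,p,q) has the property Q. *)
Definition sbm_pr (R : realType) (n : nat) (p q : R)
    (Q : {set {set sbm_vertex n}} -> Prop) : R :=
  \sum_(E in powerset (vpairs (sbm_vertex n)) | `[< Q E >])
    \prod_(e in vpairs (sbm_vertex n))
      (if e \in E then edge_prob p q e else 1 - edge_prob p q e).

Definition whp (R : realType) (p q : nat -> R)
    (Q : forall n, {set {set sbm_vertex n}} -> Prop) : Prop :=
  exists c : R, 0 < c /\
    \forall n \near \oo, 1 - n%:R `^ (- c) <= sbm_pr (p n) (q n) (@Q n).

(* An isolated vertex has nobody to sample from; letting it sample itself
   makes it keep its opinion. *)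
Definition pollees (V : finType) (E : {set {set V}}) (v : V) : {set V} :=
  if nbrs E v == finset.set0 then [set v]%SET else nbrs E v.

(* A round is a function giving the two vertices sampled by each vertex. *)
Definition round_pmf (R : realType) (V : finType) (E : {set {set V}})
    (s : {ffun V -> V * V}) : R :=
  \prod_v (if ((s v).1 \in pollees E v) && ((s v).2 \in pollees E v)
           then (#|pollees E v|%:R ^+ 2)^-1 else 0).

Definition best_of_two (V : finType) (s : {ffun V -> V * V}) (A : {set V}) :
    {set V} :=
  [set v | if ((s v).1 \in A) == ((s v).2 \in A) then (s v).1 \in A
           else v \in A].

(* The rounds W 0, W 1, ... are independent with law round_pmf E. *)
Definition voting_rounds (R : realType) (V : finType) (E : {set {set V}})
    (d : measure_display) (Omega : measurableType d) (P : probability Omega R)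
    (W : nat -> Omega -> {ffun V -> V * V}) : Prop :=
  (forall t s, measurable [set w | W t w = s]) /\
  (forall m (s : nat -> {ffun V -> V * V}),
     P [set w | forall t, (t < m)%N -> W t w = s t] =
     (\prod_(t < m) round_pmf R E (s t))%:E).

(* opinions W A t w is A^(t), the set of vertices holding opinion 1. *)
Fixpoint opinions (V : finType) (Omega : Type)
    (W : nat -> Omega -> {ffun V -> V * V}) (A : {set V}) (t : nat)
    (w : Omega) : {set V} :=
  if t is t'.+1 then best_of_two (W t' w) (opinions W A t' w) else A.

(* The infimum of the empty set is +oo. *)
Definition Tcons (R : realType) (V : finType) (Omega : Type)
    (W : nat -> Omega -> {ffun V -> V * V}) (A : {set V}) (w : Omega) :
    \bar R :=
  ereal_inf [set t%:R%:E | t in [set t : nat |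
    opinions W A t w = finset.set0 \/ opinions W A t w = [set: V]%SET]].

(* | |A| - |V \ A| | *)
Definition bias (R : realType) (V : finType) (A : {set V}) : R :=
  `| #|A|%:R - #|(~: A)%SET|%:R |.

(* Main.v *)
Require Import Defs.
From HB Require Import structures.
From mathcomp Require Import all_boot all_order all_algebra.
From mathcomp Require Import all_classical all_reals all_analysis.
From mathcomp Require Import ring lra.

(** Write alpha_i for the fraction of block i that holds opinion 1, and
    delta = alpha_1 + alpha_2 - 1, gamma = alpha_1 - alpha_2. If every vertex
    saw the exact block proportions, one round would act on (delta, gamma) by
    the cubic map [next_delta], [next_gamma], which depends on r only through
    u = (1 - r) / (1 + r). Besides consensus and the balanced state (0, 0), it
    has two fixed points delta = 0, gamma^2 = (2u - 1) / u^2 when u > 1/2: each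
    block agrees up to a fraction, on opposite opinions. They repel in the
    direction of delta when u^2 + u < 1 and attract when u^2 + u > 1, and
    u^2 + u = 1 is exactly r = sqrt 5 - 2.

    The graph is close to its mean in a sense that holds for all sets A at
    once, so that A may be chosen after the graph ([good_graph]). Chernoff
    bounds and union bounds give three properties: all degrees are nearly equal
    ([whp_good_degrees]); the numbers of neighbours in A have small total
    deviation, because the 16^n pairs (A, signs) cost only a factor exp(O(n))
    against exp(-c n^2 p) ([whp_good_cuts]); and few vertices see a small set A
    in more than a fraction max(sqrt(|A|/n), (np)^(-1/4)) of their
    neighbourhood ([whp_good_exposure]). By the first two properties, one round
    from any A lands within a small constant of the image of (delta, gamma),
    except with probability exp(-c n) ([vote_step_near]).

    Below the critical r, a region around such a fixed point is mapped strictly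
    into itself ([saddle_trap]); it contains states with delta bounded away from
    0, and one leaves it with probability at most exp(-c n) per round, whence
    the exponential lower bound ([trap_no_consensus]).

    Above the critical r, a bounded number of iterations brings every state
    with delta >= kappa/2 close to consensus, uniformly
    ([mean_field_converges]), and the vote follows because the map is
    Lipschitz ([bulk_track]). The minority is then small, and the third graph
    property bounds the expectation of its next size, given its size s, by
    20 s max(sqrt(s/n), (np)^(-1/4)). While the first term of the maximum
    dominates, s/n is raised to the power 3/2, which lasts O(log log n) rounds;
    otherwise s loses a factor of a power of np, which lasts
    O(log n / log(np)) rounds. Exponential concentration carries this down to
    s <= 4 sqrt n ([shrunk_prob]), and from there Markov's inequality, iterated
    in [extinct], finishes with the geometric rate alone.

    Only the one-dimensional laws of the voting process matter, since consensus
    is absorbing: all estimates are about [vote_prob], an iterated finite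
    expectation, and [prob_opinions] identifies it with the law of the opinions
    on an arbitrary probability space. *)

Set Implicit Arguments.
Unset Strict Implicit.
Unset Printing Implicit Defensive.

Import Order.TTheory GRing.Theory Num.Theory.
Import numFieldNormedType.Exports.

Local Open Scope ring_scope.

(** * One round of voting *)

(** Inverting 1 - x <= exp(-x). The additive Chernoff bounds below need their
    exponents to stay below 1/2 for this. *)
Lemma expR_le_quad (R : realType) (x : R) : x <= 1/2 -> expR x <= 1 + x + 2 * x ^+ 2.
Proof.
move=> hx.
have h1 : 1 - x <= expR (- x) by have := expR_ge1Dx (- x).
have h0 : 0 < 1 - x by lra.
have : expR x <= (1 - x)^-1.
  by rewrite -[expR x]invrK -expRN lef_pV2 ?posrE ?expR_gt0.
move=> /le_trans; apply.
rewrite -[_^-1]mul1r ler_pdivrMr //.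
have : 0 <= x ^+ 2 * (1 - 2 * x) by rewrite mulr_ge0 ?sqr_ge0 //; lra.
rewrite -subr_ge0 => H; rewrite -subr_ge0.
suff -> : (1 + x + 2 * x ^+ 2) * (1 - x) - 1 = x ^+ 2 * (1 - 2 * x) by lra.
by ring.
Qed.

Section Round.
Context {R : realType} {V : finType} (E : {set {set V}}).
Implicit Types (A B S : {set V}) (f g : {set V} -> R).

Definition vote_frac A v : R := #|pollees E v :&: A|%:R / #|pollees E v|%:R.

(** The probability that v holds opinion 1 after a round: a holder of opinion 1
    loses it only if both samples hold opinion 2, and a holder of opinion 2
    gains it only if both samples hold opinion 1. *)
Definition adopt A v : R :=
  if v \in A then 1 - (1 - vote_frac A v) ^+ 2 else vote_frac A v ^+ 2.

(** The expectation of f after one round from A; the transition operator of the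
    voting chain. *)
Definition vote_step f A : R :=
  \sum_s round_pmf R E s * f (best_of_two s A).

Lemma pollees_gt0 v : (0 < #|pollees E v|)%N.
Proof.
rewrite /pollees; case: ifP => [_|/negbT]; first by rewrite cards1.
by rewrite card_gt0.
Qed.

Lemma poll_fracC A v :
  #|pollees E v :&: ~: A|%:R / #|pollees E v|%:R = 1 - vote_frac A v.
Proof.
have := cardsID A (pollees E v); rewrite finset.setDE => H.
have h0 : #|pollees E v|%:R != 0 :> R by rewrite pnatr_eq0 -lt0n pollees_gt0.
rewrite /vote_frac.
have -> : 1 = #|pollees E v|%:R / #|pollees E v|%:R :> R by rewrite divff.
rewrite -[X in X%:R / _ - _]H natrD; field.
exact: h0.
Qed.

Lemma vote_frac_ge0 A v : 0 <= vote_frac A v.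
Proof. by rewrite divr_ge0. Qed.

Lemma vote_frac_le1 A v : vote_frac A v <= 1.
Proof.
by rewrite ler_pdivrMr ?ltr0n ?pollees_gt0 // mul1r ler_nat subset_leq_card ?finset.subsetIl.
Qed.

Lemma adopt_ge0 A v : 0 <= adopt A v.
Proof.
rewrite /adopt; case: ifP => _; last exact: sqr_ge0.
have := vote_frac_ge0 A v; have := vote_frac_le1 A v; nra.
Qed.

Lemma adopt_le1 A v : adopt A v <= 1.
Proof.
rewrite /adopt; have := vote_frac_ge0 A v; have := vote_frac_le1 A v.
by case: ifP => _; nra.
Qed.

Definition poll_pmf v (ab : V * V) : R :=
  if (ab.1 \in pollees E v) && (ab.2 \in pollees E v)
  then (#|pollees E v|%:R ^+ 2)^-1 else 0.

Lemma sum_poll_pmf v (X Y : {set V}) :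
  \sum_ab poll_pmf v ab * ((ab.1 \in X) && (ab.2 \in Y))%:R =
  (#|pollees E v :&: X|%:R / #|pollees E v|%:R) *
  (#|pollees E v :&: Y|%:R / #|pollees E v|%:R).
Proof.
set c := #|pollees E v|%:R.
transitivity (\sum_(a in pollees E v :&: X) \sum_(b in pollees E v :&: Y) (c ^+ 2)^-1).
  rewrite pair_big /= [RHS]big_mkcond; apply: eq_bigr => -[a b] _.
  rewrite /poll_pmf /= !inE -/c.
  by do 4 case: (_ \in _); rewrite /= ?mulr1 ?mulr0.
under eq_bigr do rewrite sumr_const.
rewrite sumr_const -[LHS]mulr_natr -[X in X * _]mulr_natr expr2 invfM; ring.
Qed.

(** Independence of the vertices: the law of a round is a product over vertices,
    so a product of functions of the single samples has a product expectation.
    *)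
Lemma sum_round_pmf (h : V -> V * V -> R) :
  \sum_s round_pmf R E s * \prod_v h v (s v) =
  \prod_v \sum_ab poll_pmf v ab * h v ab.
Proof.
rewrite bigA_distr_bigA; apply: eq_bigr => s _.
by rewrite /round_pmf -big_split.
Qed.

Definition new_opinion A v (ab : V * V) : bool :=
  if (ab.1 \in A) == (ab.2 \in A) then ab.1 \in A else v \in A.

Lemma sum_poll_total v : \sum_ab poll_pmf v ab = 1.
Proof.
have := sum_poll_pmf v [set: V]%SET [set: V]%SET.
rewrite finset.setIT divff ?mulr1; last by rewrite pnatr_eq0 -lt0n pollees_gt0.
by move=> <-; apply: eq_bigr => ab _; rewrite !inE mulr1.
Qed.

Lemma sum_poll_adopt A v :
  \sum_ab poll_pmf v ab * (new_opinion A v ab)%:R = adopt A v.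
Proof.
rewrite /adopt; case: ifP => vA.
  have := sum_poll_pmf v (~: A) (~: A); rewrite poll_fracC => H.
  rewrite expr2 -H -[X in X - _](sum_poll_total v) -sumrB; apply: eq_bigr => ab _.
  rewrite /new_opinion vA !inE -[X in X - _]mulr1 -mulrBr; congr (_ * _).
  by do 2 case: (_ \in A); rewrite /= ?subr0 ?subrr.
have := sum_poll_pmf v A A; rewrite -/(vote_frac A v) => H.
rewrite expr2 -H; apply: eq_bigr => ab _.
rewrite /new_opinion vA; congr (_ * _).
by do 2 case: (_ \in A).
Qed.

(** The joint generating function of the new opinions. Every later statement
    about one round (marginals, mean size, exponential moments) is a choice of
    z. *)
Lemma vote_step_prod (z : V -> R) A :
  vote_step (fun B => \prod_(v in B) z v) A =
  \prod_v (1 + adopt A v * (z v - 1)).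
Proof.
rewrite /vote_step.
transitivity (\sum_s round_pmf R E s *
    \prod_v (if new_opinion A v (s v) then z v else 1)).
  apply: eq_bigr => s _; congr (_ * _).
  by rewrite big_mkcond; apply: eq_bigr => v _; rewrite inE.
rewrite (sum_round_pmf (fun v ab => if new_opinion A v ab then z v else 1)).
apply: eq_bigr => v _.
rewrite -[X in _ = X + _](sum_poll_total v) -sum_poll_adopt mulr_suml -big_split /=.
apply: eq_bigr => ab _.
by case: (new_opinion _ _ _); rewrite /= ?mulr1 ?mulr0 ?mul0r; ring.
Qed.

Lemma round_pmf_ge0 (s : {ffun V -> V * V}) : 0 <= round_pmf R E s.
Proof.
by apply: prodr_ge0 => v _; case: ifP => _ //; rewrite invr_ge0 exprn_ge0.
Qed.

Lemma round_pmf_sum1 : \sum_s round_pmf R E s = 1.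
Proof.
have := sum_round_pmf (fun _ _ => 1).
rewrite (eq_bigr (round_pmf R E)) => [->|s _]; last by rewrite big1 ?mulr1.
apply: big1 => v _; rewrite -[RHS](sum_poll_total v).
by apply: eq_bigr => ab _; rewrite mulr1.
Qed.

Lemma eq_vote_step f g A : f =1 g -> vote_step f A = vote_step g A.
Proof. by move=> fg; apply: eq_bigr => s _; rewrite fg. Qed.

Lemma le_vote_step f g A : (forall B, f B <= g B) -> vote_step f A <= vote_step g A.
Proof. by move=> fg; apply: ler_sum => s _; rewrite ler_wpM2l ?round_pmf_ge0. Qed.

(** Contains the fact that the round probabilities add up to 1. *)
Lemma vote_step_affine a c f A :
  vote_step (fun B => a + c * f B) A = a + c * vote_step f A.
Proof.
rewrite /vote_step mulr_sumr -[a in RHS]mulr1 -round_pmf_sum1 mulr_sumr -big_split.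
by apply: eq_bigr => s _; rewrite mulrDr !mulrA [_ * a]mulrC [_ * c]mulrC.
Qed.

Lemma vote_step_mem A v : vote_step (fun B => (v \in B)%:R) A = adopt A v.
Proof.
have H := vote_step_prod (fun u => (u != v)%:R) A.
have H1 : vote_step (fun B => 1 + (-1) * (v \in B)%:R) A = 1 - adopt A v.
  transitivity (\prod_u (1 + adopt A u * ((u != v)%:R - 1))); last first.
    rewrite (bigD1 v) //= eqxx big1 => [|u /negPf ->]; last by rewrite subrr mulr0 addr0.
    by rewrite mulr1 sub0r mulrN mulr1.
  rewrite -H; apply: eq_vote_step => B.
  have [vB|vB] := boolP (v \in B).
    by rewrite (bigD1 v) //= eqxx mul0r mulr1 subrr.
  rewrite big1 ?mulr0 ?addr0 // => u uB.
  by case: eqVneq uB vB => // -> ->.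
by rewrite vote_step_affine in H1; lra.
Qed.

Lemma vote_step_sum (I : finType) (f : I -> {set V} -> R) A :
  vote_step (fun B => \sum_i f i B) A = \sum_i vote_step (f i) A.
Proof.
rewrite /vote_step exchange_big /=; apply: eq_bigr => s _.
by rewrite mulr_sumr.
Qed.

Lemma vote_stepD f g A :
  vote_step (fun B => f B + g B) A = vote_step f A + vote_step g A.
Proof. by rewrite /vote_step -big_split; apply: eq_bigr => s _; rewrite mulrDr. Qed.

Lemma vote_stepZ c f A : vote_step (fun B => c * f B) A = c * vote_step f A.
Proof.
by rewrite /vote_step mulr_sumr; apply: eq_bigr => s _; rewrite mulrCA.
Qed.

Lemma vote_step_card A : vote_step (fun B => #|B|%:R) A = \sum_v adopt A v.
Proof.
rewrite (@eq_vote_step _ (fun B => \sum_v (v \in B)%:R)); last first.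
  by move=> B; rewrite -sum1_card natr_sum big_mkcond /=; apply: eq_bigr => v _; case: ifP.
by rewrite vote_step_sum; apply: eq_bigr => v _; exact: vote_step_mem.
Qed.

(** The new opinions are independent Bernoulli variables, so their exponential
    moments are at most those of a Poisson variable of the same mean. *)
Lemma vote_step_expR S (t : R) A :
  vote_step (fun B => expR (t * #|B :&: S|%:R)) A <=
  expR ((expR t - 1) * \sum_(v in S) adopt A v).
Proof.
rewrite (@eq_vote_step _ (fun B =>
    \prod_(v in B) (if v \in S then expR t else 1))); last first.
  move=> B; rewrite mulrC expRM_natl -prodr_const big_mkcond [RHS]big_mkcond /=.
  by apply: eq_bigr => v _; rewrite inE; case: (v \in B) => //=.
rewrite vote_step_prod mulr_sumr expR_sum [leRHS]big_mkcond /=.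
apply: ler_prod => v _; have p0 := adopt_ge0 A v; have p1 := adopt_le1 A v.
have t0 := expR_gt0 t.
case: ifP => _; last by rewrite subrr mulr0 addr0 ler01 lexx.
have := expR_ge1Dx ((expR t - 1) * adopt A v); rewrite [_ * adopt A v]mulrC => ->; rewrite andbT.
by nra.
Qed.

(** Exponential Markov inequality with parameter 1/2, where exp(1/2) - 1 <= 1.
    The mean may be far below M, which is how a floor of order sqrt n enters
    later. *)
Lemma vote_chernoff_large A (M : R) : \sum_v adopt A v <= M ->
  vote_step (fun B => (4 * M <= #|B|%:R)%R%:R) A <= expR (- M).
Proof.
move=> hM.
have M0 : 0 <= M by apply: le_trans hM; apply: sumr_ge0 => v _; exact: adopt_ge0.
have hq := expR_le_quad (lexx (1/2 : R)).
apply: le_trans (_ : expR (- (2 * M)) * vote_step (fun B => expR (1/2 * #|B :&: [set: V]%SET|%:R)) A <= _).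
  rewrite -[leRHS]add0r -vote_step_affine; apply: le_vote_step => B.
  rewrite add0r finset.setIT -expRD.
  case: (lerP (4 * M)) => h /=; last exact: expR_ge0.
  by rewrite -[X in X <= _]expR0 ler_expR; lra.
apply: le_trans (ler_wpM2l (expR_ge0 _) (vote_step_expR _ _ _)) _.
rewrite -expRD ler_expR.
rewrite (eq_bigl predT) => [|v]; last by rewrite !inE.
have s0 : 0 <= \sum_v adopt A v by apply: sumr_ge0 => v _; exact: adopt_ge0.
nra.
Qed.

(** Exponential Markov inequality with parameters e/4 and -e/4. *)
Lemma vote_chernoff A S (N e : R) : #|S|%:R <= N -> 0 <= e -> e <= 1 ->
  vote_step (fun B => (e * N <= `|#|B :&: S|%:R - \sum_(v in S) adopt A v|)%R%:R) A
  <= 2 * expR (- (e ^+ 2 * N / 8)).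
Proof.
move=> hS e0 e1; set mu := \sum_(v in S) _.
have N0 : 0 <= N by apply: le_trans hS.
have mu0 : 0 <= mu by apply: sumr_ge0 => v _; exact: adopt_ge0.
have muN : mu <= N.
  apply: le_trans hS; rewrite -sum1_card natr_sum; apply: ler_sum => v _.
  exact: adopt_le1.
set t := e / 4.
pose g (s : R) B := expR (s * #|B :&: S|%:R).
have main (s : R) : s ^+ 2 = t ^+ 2 -> s <= 1/2 ->
    expR (- (s * mu) - t * (e * N)) * vote_step (g s) A <= expR (- (e ^+ 2 * N / 8)).
  move=> s2 s1.
  apply: le_trans (ler_wpM2l (expR_ge0 _) (vote_step_expR _ _ _)) _.
  rewrite -expRD ler_expR -/mu.
  have hq := expR_le_quad s1.
  have : (expR s - 1) * mu <= s * mu + 2 * t ^+ 2 * N.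
    have : (expR s - 1) * mu <= (s + 2 * s ^+ 2) * mu by rewrite ler_wpM2r //; lra.
    have : 2 * t ^+ 2 * mu <= 2 * t ^+ 2 * N.
      by rewrite ler_wpM2l // mulr_ge0 // sqr_ge0.
    rewrite s2; lra.
  rewrite /t; lra.
have t2 : (- t) ^+ 2 = t ^+ 2 by rewrite sqrrN.
have tl : t <= 1/2 by rewrite /t; lra.
have tl' : - t <= 1/2 by rewrite /t; lra.
have := lerD (main t erefl tl) (main (- t) t2 tl').
rewrite -[X in _ <= X]mulr2n -[X in _ <= X]mulr_natl; apply: le_trans.
rewrite -!vote_stepZ -vote_stepD; apply: le_vote_step => B.
rewrite /g -!expRD; case: (lerP (e * N)) => h /=; last by rewrite addr_ge0 ?expR_ge0.
have t0 : 0 <= t by rewrite /t; lra.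
set x := #|_|%:R in h *.
have [xm|xm] := lerP mu x.
  rewrite ger0_norm ?subr_ge0 // in h.
  apply: ler_wpDr (expR_ge0 _) _; rewrite -[X in X <= _]expR0 ler_expR.
  have := ler_wpM2l t0 h; lra.
rewrite ltr0_norm ?subr_lt0 // in h.
apply: ler_wpDl (expR_ge0 _) _; rewrite -[X in X <= _]expR0 ler_expR.
have := ler_wpM2l t0 h; lra.
Qed.
End Round.

(** * Several rounds of voting *)

Section Iterate.
Context {R : realType} {V : finType} (E : {set {set V}}).
Implicit Types (A B S : {set V}) (f g : {set V} -> R).
Local Notation T := (@vote_step R V E).

(** The probability that the opinions lie in X after k rounds from A, defined
    backwards: the outermost step is the first round. *)
Definition vote_prob k (X : pred {set V}) A : R :=
  iter k T (fun B => (X B)%:R) A.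

Lemma le_vote_iter k f g A : (forall B, f B <= g B) -> iter k T f A <= iter k T g A.
Proof.
by move=> fg; elim: k A => //= k IH A; apply: le_vote_step.
Qed.

Lemma vote_iter_affine k a c f A :
  iter k T (fun B => a + c * f B) A = a + c * iter k T f A.
Proof.
elim: k A => //= k IH A.
by rewrite -vote_step_affine; apply: eq_vote_step => B.
Qed.

Lemma vote_iter_cst k c A : iter k T (fun _ => c) A = c.
Proof.
elim: k A => //= k IH A; rewrite /vote_step.
by under eq_bigr do rewrite IH; rewrite -mulr_suml round_pmf_sum1 mul1r.
Qed.

Lemma vote_prob_le1 k X A : vote_prob k X A <= 1.
Proof.
by rewrite -[leRHS](vote_iter_cst k 1 A); apply: le_vote_iter => B; rewrite lern1 leq_b1.
Qed.

Lemma vote_prob_sub k (X Y : pred {set V}) A : (forall B, X B -> Y B) ->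
  vote_prob k X A <= vote_prob k Y A.
Proof.
move=> XY; apply: le_vote_iter => B; rewrite ler_nat.
by case XB: (X B) => //; rewrite XY.
Qed.

Lemma vote_probC k (X : pred {set V}) A :
  vote_prob k X A = 1 - vote_prob k (fun B => ~~ X B) A.
Proof.
rewrite /vote_prob -[X in 1 - X]mul1r -mulNr -vote_iter_affine.
congr (iter _ _ _ _); apply: funext => B.
by case: (X B); rewrite /= ?mulr0 ?addr0 // mulN1r subrr.
Qed.

(** The Markov property in the form used throughout: failures of successive
    phases add up. *)
Lemma vote_prob_comp k l (Y Z : pred {set V}) (e1 e2 : R) A :
  0 <= e2 ->
  vote_prob k (fun B => ~~ Y B) A <= e1 ->
  (forall B, Y B -> vote_prob l (fun B => ~~ Z B) B <= e2) ->
  vote_prob (k + l) (fun B => ~~ Z B) A <= e1 + e2.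
Proof.
move=> e20 h1 h2; rewrite /vote_prob iterD.
apply: le_trans (_ : e2 + 1 * vote_prob k (fun B => ~~ Y B) A <= _); last by rewrite mul1r; lra.
rewrite -vote_iter_affine; apply: le_vote_iter => B.
have [YB|NYB] := boolP (Y B); first by rewrite mulr0 addr0; exact: h2.
have := vote_prob_le1 l (fun B => ~~ Z B) B.
by rewrite /vote_prob /= mulr1; lra.
Qed.

(** Exchanging the names of the two opinions commutes with a round, so it
    suffices to study a majority for opinion 1 and the extinction of a minority.
    *)
Lemma best_of_twoC (s : {ffun V -> V * V}) A :
  best_of_two s (~: A) = (~: best_of_two s A)%SET.
Proof.
apply/setP => v; rewrite !inE.
by do 3 case: (_ \in A).
Qed.

Lemma vote_stepC f A : T f (~: A)%SET = T (fun B => f (~: B)%SET) A.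
Proof. by apply: eq_bigr => s _; rewrite best_of_twoC. Qed.

Lemma vote_probC_set k (X : pred {set V}) A :
  vote_prob k X (~: A)%SET = vote_prob k (fun B => X (~: B)%SET) A.
Proof.
rewrite /vote_prob; elim: k A => //= k IH A.
by rewrite vote_stepC; apply: eq_vote_step => B; rewrite IH.
Qed.

Definition consensus : pred {set V} :=
  fun B => (B == finset.set0) || (B == [set: V]%SET).

Lemma consensus_next (s : {ffun V -> V * V}) B :
  consensus B -> consensus (best_of_two s B).
Proof.
by case/orP=> /eqP ->; apply/orP; [left|right]; apply/eqP/setP => v; rewrite !inE.
Qed.

End Iterate.

(** * Exponential moments of the random graph *)

Section RandomSubset.
Context {R : realType} {T : finType} (D : {set T}) (pe : T -> R).

Definition subset_weight (E : {set T}) : R :=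
  \prod_(e in D) (if e \in E then pe e else 1 - pe e).

(** The generating function of a random subset with independent elements:
    expanding the product over D into a sum over subsets. *)
Lemma sum_subset_weight (z : T -> R) :
  \sum_(E in powerset D) subset_weight E * \prod_(e in E) z e =
  \prod_(e in D) (1 + pe e * (z e - 1)).
Proof.
pose F e := if e \in D then pe e * z e else 0.
pose G e := if e \in D then 1 - pe e else 1.
transitivity (\prod_e (F e + G e)); last first.
  rewrite [RHS]big_mkcond; apply: eq_bigr => e _; rewrite /F /G.
  by case: ifP => _; [ring|rewrite add0r].
rewrite bigA_distr big_mkcond /=; apply: eq_bigr => E _.
rewrite powersetE; case: ifPn => [ED|/fintype.subsetPn[e eE eD]]; last first.
  by rewrite (bigD1 e) //= eE /F (negPf eD) mul0r.
rewrite /subset_weight big_mkcond [X in _ * X]big_mkcond -big_split /=.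
apply: eq_bigr => e _; rewrite /F /G.
case: (boolP (e \in E)) => [eE|eE].
  by rewrite (fintype.subsetP ED).
by case: ifP; rewrite ?mulr1.
Qed.
End RandomSubset.

Section Graph.
Context {R : realType} {n : nat} (p q : R).
Hypothesis q_ge0 : 0 <= q.
Hypothesis q_le_p : q <= p.
Hypothesis p_le1 : p <= 1.
Local Notation V := (sbm_vertex n).
Implicit Types (E : {set {set V}}) (Q : {set {set V}} -> Prop).
Local Notation ep := (@edge_prob R n p q).
Local Notation gw := (subset_weight (vpairs V) ep).
Local Notation Pg := (@sbm_pr R n p q).

Lemma edge_prob_ge0 e : 0 <= ep e.
Proof. by rewrite /edge_prob; case: ifP => _ //; exact: le_trans q_le_p. Qed.

Lemma edge_prob_le e : ep e <= p.
Proof. by rewrite /edge_prob; case: ifP. Qed.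

Lemma graph_weight_ge0 E : 0 <= gw E.
Proof.
apply: prodr_ge0 => e _; have := edge_prob_ge0 e; have := edge_prob_le e; move: p_le1.
by case: ifP => _; lra.
Qed.

Lemma graph_weight_sum1 : \sum_(E in powerset (vpairs V)) gw E = 1.
Proof.
have := sum_subset_weight (vpairs V) ep (fun _ => 1).
rewrite [RHS]big1 => [<-|e _]; last by rewrite subrr mulr0 addr0.
by apply: eq_bigr => E _; rewrite big1 ?mulr1.
Qed.

Lemma sbm_prE Q : Pg Q = \sum_(E in powerset (vpairs V)) gw E * (`[< Q E >])%:R.
Proof.
rewrite /sbm_pr big_mkcondr; apply: eq_bigr => E _.
by case: asbool; rewrite ?mulr1 ?mulr0.
Qed.

(** Markov's inequality; the union bound and the monotonicity of the probability
    are instances. *)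
Lemma sbm_pr_markov Q (f : {set {set V}} -> R) :
  (forall E, 0 <= f E) -> (forall E, E \subset vpairs V -> Q E -> 1 <= f E) ->
  Pg Q <= \sum_(E in powerset (vpairs V)) gw E * f E.
Proof.
move=> f0 fQ; rewrite sbm_prE; apply: ler_sum => E; rewrite powersetE => EV.
rewrite ler_wpM2l ?graph_weight_ge0 //.
by case: asboolP => // QE; apply: fQ.
Qed.

Lemma le_sbm_pr Q Q' : (forall E, E \subset vpairs V -> Q E -> Q' E) -> Pg Q <= Pg Q'.
Proof.
move=> QQ'; rewrite [leRHS]sbm_prE; apply: sbm_pr_markov => E; first by case: asbool.
by move=> EV /(QQ' _ EV) /asboolT ->.
Qed.

Lemma sbm_pr_union (I : finType) (Q : I -> {set {set V}} -> Prop) :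
  Pg (fun E => exists i, Q i E) <= \sum_i Pg (Q i).
Proof.
under [leRHS]eq_bigr do rewrite sbm_prE.
rewrite exchange_big /=; under [leRHS]eq_bigr do rewrite -mulr_sumr.
apply: sbm_pr_markov => E; first by apply: sumr_ge0 => i _; case: asbool.
move=> _ [i Qi]; rewrite (bigD1 i) //= (asboolT Qi) lerDl.
by apply: sumr_ge0 => j _; case: asbool.
Qed.

Lemma sbm_prU Q Q' : Pg (fun E => Q E \/ Q' E) <= Pg Q + Pg Q'.
Proof.
apply: le_trans (_ : \sum_(b : bool) Pg (if b then Q else Q') <= _).
  apply: le_trans (sbm_pr_union _); apply: le_sbm_pr => E _ [] ?; [by exists true|by exists false].
by rewrite big_bool.
Qed.

Lemma sbm_pr_compl Q Q' : (forall E, E \subset vpairs V -> ~ Q' E -> Q E) ->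
  1 - Pg Q' <= Pg Q.
Proof.
move=> QQ'; rewrite !sbm_prE -[X in X - _]graph_weight_sum1 -sumrB.
apply: ler_sum => E; rewrite powersetE => EV.
have := graph_weight_ge0 E.
case: (asboolP (Q' E)) => [_|/(QQ' _ EV)/asboolT ->] w0; last by rewrite /= mulr0 subr0 mulr1.
by rewrite /= mulr1 subrr mulr_ge0.
Qed.

Implicit Types w : V -> V -> R.

(** The coefficient of the indicator of the edge e when a weighted sum over
    adjacent ordered pairs is rewritten as a sum over edges. Each edge occurs in
    both orders, and only the sum over edges has independent terms. *)
Definition pair_coef w (e : {set V}) : R :=
  \sum_(x : V * V | (x.2 != x.1) && ([set x.2; x.1]%SET == e)) w x.1 x.2.

(** Regrouping ordered pairs by the edge that they span; applied once to the
    random graph and once to the edge probabilities. *)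
Lemma sum_pair_coef w (g : {set V} -> R) :
  \sum_v \sum_(u | u != v) w v u * g [set u; v]%SET =
  \sum_(e in vpairs V) g e * pair_coef w e.
Proof.
rewrite (pair_big_dep predT (fun v u => u != v)) /=.
rewrite (partition_big (fun x : V * V => [set x.2; x.1]%SET) (mem (vpairs V))) /=; last first.
  by move=> x xx; rewrite inE cards2 xx.
apply: eq_bigr => e _; rewrite mulr_sumr; apply: eq_bigr => x /andP[_ /eqP ->].
by rewrite mulrC.
Qed.

Lemma pair_coefE w e : e \in vpairs V ->
  exists a b, a != b /\ forall w, pair_coef w e = w a b + w b a.
Proof.
rewrite inE => /cards2P [a [b [ab ->]]]; exists a, b; split => // w'.
rewrite /pair_coef.
rewrite (bigD1 (a, b)) /=; last by rewrite eq_sym ab finset.setUC eqxx.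
rewrite (bigD1 (b, a)) /=; last by rewrite ab eqxx /= xpair_eqE negb_and eq_sym ab.
rewrite big1 ?addr0 // => -[x y] /= /andP[/andP[/andP[xy /eqP e'] n1] n2].
exfalso; have : x \in [set y; x]%SET by rewrite !inE eqxx orbT.
have : y \in [set y; x]%SET by rewrite !inE eqxx.
rewrite e' !inE; move: xy n1 n2; rewrite !xpair_eqE.
case: (eqVneq x a) => [->|]; case: (eqVneq y b) => [->|]; rewrite ?eqxx //=.
- by case: (eqVneq y a) => //.
- by case: (eqVneq x b) => [->|] //=; case: (eqVneq b y) => // ->; case: (eqVneq y a) => // ->; rewrite ?eqxx.
- by case: (eqVneq x b) => [->|] //=; case: (eqVneq y a) => // ->.
Qed.

Definition adj_sum w E : R := \sum_v \sum_(u | u != v) w v u * (u \in nbrs E v)%:R.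

Lemma adj_sumE w E : E \subset vpairs V -> adj_sum w E = \sum_(e in E) pair_coef w e.
Proof.
move=> EV; rewrite /adj_sum.
transitivity (\sum_(e in vpairs V) (e \in E)%:R * pair_coef w e).
  rewrite -(sum_pair_coef w (fun e => (e \in E)%:R)).
  by apply: eq_bigr => v _; apply: eq_bigr => u uv; rewrite inE uv.
rewrite big_mkcond [RHS]big_mkcond; apply: eq_bigr => e _.
case: (boolP (e \in E)) => [eE|]; first by rewrite (fintype.subsetP EV) // mul1r.
by rewrite mul0r; case: ifP.
Qed.

Definition adj_mean w : R := \sum_v \sum_(u | u != v) w v u * ep [set u; v]%SET.

Lemma adj_meanE w : adj_mean w = \sum_(e in vpairs V) ep e * pair_coef w e.
Proof. exact: sum_pair_coef. Qed.

(** Exponential moments of a linear statistic of the adjacency relation, from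
    independence of the edges and 1 + x <= exp(x). *)
Lemma adj_mgf w (t : R) :
  \sum_(E in powerset (vpairs V)) gw E * expR (t * adj_sum w E) <=
  expR (\sum_(e in vpairs V) ep e * (expR (t * pair_coef w e) - 1)).
Proof.
rewrite (eq_bigr (fun E => gw E * \prod_(e in E) expR (t * pair_coef w e))); last first.
  by move=> E; rewrite powersetE => EV; rewrite adj_sumE // mulr_sumr expR_sum.
rewrite sum_subset_weight expR_sum; apply: ler_prod => e _.
rewrite expR_ge1Dx andbT.
have := edge_prob_ge0 e; have := edge_prob_le e; have := expR_gt0 (t * pair_coef w e); move: p_le1.
nra.
Qed.

(** Bernstein-type bound. The restriction t <= 1/4 keeps the exponents below
    1/2, since an edge is counted at most twice. *)
Lemma adj_chernoff w (t a : R) : (forall v u, `|w v u| <= 1) -> 0 <= t -> t <= 1/4 ->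
  Pg (fun E => a <= adj_sum w E - adj_mean w) <=
  expR (- (t * a) + 4 * t ^+ 2 * adj_mean (fun v u => `|w v u|)).
Proof.
move=> w1 t0 t4.
apply: le_trans (_ : expR (- (t * adj_mean w) - t * a) *
   (\sum_(E in powerset (vpairs V)) gw E * expR (t * adj_sum w E)) <= _).
  rewrite mulr_sumr; under eq_bigr do rewrite mulrCA.
  apply: sbm_pr_markov => E; first by rewrite mulr_ge0 ?expR_ge0.
  move=> _ h; rewrite -expRD -[X in X <= _]expR0 ler_expR.
  have := ler_wpM2l t0 h; lra.
apply: le_trans (ler_wpM2l (expR_ge0 _) (adj_mgf _ _)) _.
rewrite -expRD ler_expR !adj_meanE.
suff : \sum_(e in vpairs V) ep e * (expR (t * pair_coef w e) - 1) <=
   t * (\sum_(e in vpairs V) ep e * pair_coef w e) +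
   4 * t ^+ 2 * \sum_(e in vpairs V) ep e * pair_coef (fun v u => `|w v u|) e by lra.
rewrite !mulr_sumr -big_split; apply: ler_sum => e eV /=.
have [a' [b' [_ cE]]] := pair_coefE w eV.
rewrite [t * (_ * _)]mulrCA [4 * _ * (_ * _)]mulrCA -mulrDr ler_wpM2l ?edge_prob_ge0 //.
rewrite !cE; set x := w _ _; set y := w _ _.
have hx : `|x| <= 1 by exact: w1. have hy : `|y| <= 1 by exact: w1.
have hxy : `|x + y| <= `|x| + `|y| by exact: ler_normD.
set c := x + y in hxy *. 
have hc : c <= 2 by have := ler_norm c; lra.
have hq : expR (t * c) <= 1 + t * c + 2 * (t * c) ^+ 2.
  by apply: expR_le_quad; nra.
have c2 : c ^+ 2 <= 2 * (`|x| + `|y|).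
  rewrite -normr_id -real_normK ?num_real // normr_id.
  have := normr_ge0 c; nra.
have : 0 <= t ^+ 2 by exact: sqr_ge0.
rewrite exprMn in hq; nra.
Qed.

(** The large-deviation counterpart of [adj_chernoff] for the number of adjacent
    pairs between S and A, without restriction on t: it is used where this
    number exceeds its mean by a large factor. By convexity, an edge counted
    twice is the worst case. *)
Lemma adj_large (S A : {set V}) (t k : R) : 0 <= t ->
  Pg (fun E => k <= adj_sum (fun v u => ((v \in S) && (u \in A))%:R) E) <=
  expR (- (t * k) + (expR (2 * t) - 1) / 2 * (p * #|S|%:R * #|A|%:R)).
Proof.
move=> t0; set w : V -> V -> R := fun v u => ((v \in S) && (u \in A))%:R.
apply: le_trans (_ : expR (- (t * k)) *
   (\sum_(E in powerset (vpairs V)) gw E * expR (t * adj_sum w E)) <= _).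
  rewrite mulr_sumr; under eq_bigr do rewrite mulrCA.
  apply: sbm_pr_markov => E; first by rewrite mulr_ge0 ?expR_ge0.
  move=> _ h; rewrite -expRD -[X in X <= _]expR0 ler_expR.
  have := ler_wpM2l t0 h; lra.
apply: le_trans (ler_wpM2l (expR_ge0 _) (adj_mgf _ _)) _.
rewrite -expRD ler_expR lerD2l.
have e1 : 1 <= expR t by rewrite -expR0 ler_expR.
have e2 : expR (2 * t) = expR t ^+ 2 by rewrite -expRM_natl.
apply: le_trans (_ : (expR (2 * t) - 1) / 2 * adj_mean w <= _).
  rewrite adj_meanE mulr_sumr; apply: ler_sum => e eV.
  have [a [b [_ cE]]] := pair_coefE w eV.
  rewrite mulrCA ler_wpM2l ?edge_prob_ge0 // cE /w.
  rewrite e2; case: (_ && _); case: (_ && _); rewrite /= ?addr0 ?add0r ?mulr0 ?mulr1 ?expR0 ?subrr //.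
  - by rewrite -[1 + 1]/(2%:R) [t * _]mulrC e2; lra.
  - nra.
  - nra.
rewrite ler_wpM2l //; first by rewrite e2; nra.
rewrite /adj_mean.
apply: le_trans (_ : \sum_v \sum_u w v u * p <= _).
  apply: ler_sum => v _; rewrite big_mkcond; apply: ler_sum => u _.
  have p0 : 0 <= p by exact: le_trans q_le_p.
  by case: ifP => _; rewrite ?ler_wpM2l ?edge_prob_le // mulr_ge0.
rewrite /w.
have -> : p * #|S|%:R * #|A|%:R = \sum_(v in S) \sum_(u in A) p.
  under eq_bigr do rewrite sumr_const.
  by rewrite sumr_const -[RHS]mulr_natr -[p *+ _]mulr_natr mulrAC.
rewrite [leRHS]big_mkcond; apply: ler_sum => v _.
case: (v \in S) => /=; last by rewrite big1 // => u _; rewrite mul0r.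
rewrite [leRHS]big_mkcond; apply: ler_sum => u _.
by case: (u \in A); rewrite ?mul1r ?mul0r.
Qed.
End Graph.

(** * Degrees and cuts of the random graph *)

Section GoodGraph.
Context {R : realType} {n : nat} (p q : R).
Hypothesis q_ge0 : 0 <= q.
Hypothesis q_le_p : q <= p.
Hypothesis p_le1 : p <= 1.
Local Notation V := (sbm_vertex n).
Implicit Types (E : {set {set V}}) (A S : {set V}).
Local Notation ep := (@edge_prob R n p q).
Local Notation Pg := (@sbm_pr R n p q).
Local Notation N := (n%:R : R).

Definition deg_in E A (v : V) : R := #|nbrs E v :&: A|%:R.

(** The expected number of neighbours in A of a vertex of block i, up to the
    missing loop. *)
Definition mean_in A (i : bool) : R :=
  p * #|A :&: block n i|%:R + q * #|A :&: block n (~~ i)|%:R.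

Lemma edge_prob_pair (u v : V) : ep [set u; v]%SET = if u.1 == v.1 then p else q.
Proof.
rewrite /edge_prob; congr (if _ then _ else _).
apply/existsP/eqP => [[i /fintype.subsetP uvi]|uv].
  have /[!inE]/eqP -> := uvi u (set21 u v).
  by have /[!inE]/eqP -> := uvi v (set22 u v).
by exists v.1; apply/fintype.subsetP => x /set2P[] ->; rewrite inE // uv.
Qed.

Lemma sum_edge_prob A (v : V) : \sum_(u in A) ep [set u; v]%SET = mean_in A v.1.
Proof.
under eq_bigr do rewrite edge_prob_pair.
rewrite (bigID (fun u : V => u.1 == v.1)) /=; congr (_ + _).
  rewrite (eq_bigr (fun _ => p)) => [|u /andP[_ ->]//].
  rewrite mulr_natr -sumr_const; apply: eq_bigl => u; by rewrite !inE.
rewrite (eq_bigr (fun _ => q)) => [|u /andP[_ /negPf ->]//].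
rewrite mulr_natr -sumr_const; apply: eq_bigl => u; rewrite !inE.
by case: u.1; case: v.1.
Qed.

Lemma card_block (i : bool) : #|block n i| = n.
Proof.
rewrite -[RHS]card_ord -(card_imset _ (fun a b : 'I_n => fun h : (i, a) = (i, b) => congr1 snd h)).
apply: eq_card => -[j k]; rewrite inE /=; apply/eqP/imsetP => [->|[x _ [-> _]]//].
by exists k.
Qed.

Lemma card_sbm_vertex : #|{: V}| = n.*2.
Proof. by rewrite card_prod card_bool card_ord mul2n. Qed.

Lemma card_cap_block_le A i : #|A :&: block n i|%:R <= N.
Proof. by rewrite ler_nat -[leqRHS](card_block i) subset_leq_card // finset.subsetIr. Qed.

Lemma mean_in_le A i : mean_in A i <= 2 * (N * p).
Proof.
have p0 : 0 <= p by exact: le_trans q_le_p.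
have h1 := ler_wpM2l p0 (card_cap_block_le A i).
have h2 := ler_wpM2l q_ge0 (card_cap_block_le A (~~ i)).
have h3 := ler_wpM2r (ler0n R n) q_le_p.
rewrite /mean_in; lra.
Qed.

Lemma adj_sum_deg (s : V -> R) A E :
  adj_sum (fun v u => s v * (u \in A)%:R) E = \sum_v s v * deg_in E A v.
Proof.
apply: eq_bigr => v _; rewrite /deg_in -sum1_card natr_sum mulr_sumr.
rewrite big_mkcond [RHS]big_mkcond /=; apply: eq_bigr => u _.
rewrite !inE; case: (eqVneq u v) => //= _.
by case: (_ \in E); case: (u \in A); rewrite /= ?mulr1 ?mulr0.
Qed.

(** A vertex is not its own neighbour, so the exact mean differs from [mean_in]
    by at most p per vertex. *)
Lemma adj_mean_deg (s : V -> R) A :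
  `|adj_mean p q (fun v u => s v * (u \in A)%:R) - \sum_v s v * mean_in A v.1|
  <= p * \sum_v `|s v|.
Proof.
rewrite -sumrB mulr_sumr; apply: le_trans (ler_norm_sum _ _ _) _.
apply: ler_sum => v _.
rewrite -sum_edge_prob mulr_sumr [X in _ - X]big_mkcond /=.
rewrite [X in _ - X](bigID (fun u => u != v)) /= opprD addrA -sumrB.
rewrite [X in X - _]big1 => [|u _]; last first.
  by case: (u \in A); rewrite /= ?mulr1 ?subrr // mulr0 mul0r subrr.
rewrite (big_pred1 v) => [|u]; last by rewrite negbK.
rewrite sub0r normrN; case: ifP => _; last by rewrite normr0 mulr_ge0 //; exact: le_trans q_le_p.
rewrite normrM mulrC ler_wpM2r //.
by rewrite ger0_norm ?edge_prob_le // (edge_prob_ge0 q_ge0 q_le_p).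
Qed.

Lemma adj_mean_abs (s : V -> R) A :
  adj_mean p q (fun v u => `|s v * (u \in A)%:R|) <= 2 * (N * p) * \sum_v `|s v|.
Proof.
rewrite mulr_sumr; apply: ler_sum => v _.
apply: le_trans (_ : `|s v| * mean_in A v.1 <= _); last first.
  by rewrite mulrC ler_wpM2r // mean_in_le.
rewrite -sum_edge_prob mulr_sumr big_mkcond [leRHS]big_mkcond /=.
apply: ler_sum => u _; have h := @edge_prob_ge0 R n p q q_ge0 q_le_p [set u; v]%SET.
case: ifP => _; rewrite ?normrM; case: (u \in A); rewrite /= ?normr1 ?normr0 ?mulr1 ?mulr0 ?mul0r //.
by rewrite mulr_ge0.
Qed.

(** One bound for degrees and cuts: signs carried by one vertex give its degree,
    signs carried by all vertices give a total deviation. Missing loops are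
    negligible once e n is at least 2. *)
Lemma sbm_linear_dev (s : V -> R) A (e : R) :
  (forall v, `|s v| <= 1) -> 0 < e -> e <= 1 -> 2 <= e * N ->
  Pg (fun E => e * (N * p) * \sum_v `|s v| <= \sum_v s v * (deg_in E A v - mean_in A v.1))
  <= expR (- (e ^+ 2 * (N * p) * (\sum_v `|s v|) / 128)).
Proof.
move=> s1 e0 e1 eN; set S1 := \sum_v `|s v|.
have p0 : 0 <= p by exact: le_trans q_le_p.
have S0 : 0 <= S1 by exact: sumr_ge0.
pose w (v u : V) := s v * (u \in A)%:R.
have t0 : 0 <= e / 32 by lra.
have t1 : e / 32 <= 1 / 4 by lra.
have w1 v u : `|w v u| <= 1.
  by rewrite normrM; case: (u \in A); rewrite /= ?normr1 ?normr0 ?mulr1 ?mulr0.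
apply: le_trans (_ : Pg (fun E => e * (N * p) * S1 / 2 <= adj_sum w E - adj_mean p q w) <= _).
  apply: le_sbm_pr => // E _.
  rewrite adj_sum_deg; under eq_bigr do rewrite mulrBr; rewrite sumrB => h.
  have := adj_mean_deg s A; rewrite ler_norml -/w -/S1 => /andP[_ h2].
  have h3 : p * S1 * 2 <= p * S1 * (e * N) by rewrite ler_wpM2l // mulr_ge0.
  lra.
apply: le_trans (adj_chernoff _ _ _ _ w1 t0 t1) _ => //.
rewrite ler_expR.
have h := adj_mean_abs s A.
have := ler_wpM2l (sqr_ge0 (e / 32)) h; rewrite -/w -/S1.
set X := adj_mean _ _ _; lra.
Qed.

Definition good_degrees (e : R) E :=
  forall v, `|#|nbrs E v|%:R - (N * p + N * q)| <= e * (N * p).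

(** A bound on the sum of absolute deviations; the sign pattern that attains the
    absolute values is part of the union bound. *)
Definition good_cuts (e : R) E :=
  forall A, \sum_v `|deg_in E A v - mean_in A v.1| <= 2 * N * (e * (N * p)).

Lemma whp_good_degrees (e : R) : 0 < e -> e <= 1 -> 2 <= e * N ->
  Pg (fun E => ~ good_degrees e E) <= 4 * N * expR (- (e ^+ 2 * (N * p) / 128)).
Proof.
move=> e0 e1 eN.
pose s (vb : V * bool) v : R := (-1) ^+ vb.2 * (v == vb.1)%:R.
have sA vb : \sum_v `|s vb v| = 1.
  rewrite (bigD1 vb.1) //= /s eqxx mulr1 normr_sign big1 ?addr0 // => v /negPf ->.
  by rewrite mulr0 normr0.
have s1 vb v : `|s vb v| <= 1.
  by rewrite normrM normr_sign mul1r; case: eqP; rewrite ?normr1 ?normr0.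
apply: le_trans (_ : Pg (fun E => exists vb, e * (N * p) * \sum_v `|s vb v| <=
    \sum_v s vb v * (deg_in E [set: V]%SET v - mean_in [set: V]%SET v.1)) <= _).
  apply: le_sbm_pr => // E _ /existsNP[v /negP]; rewrite -ltNge => h.
  have dE : deg_in E [set: V]%SET v = #|nbrs E v|%:R by rewrite /deg_in finset.setIT.
  have mE : mean_in [set: V]%SET v.1 = N * p + N * q.
    by rewrite /mean_in !finset.setTI !card_block [p * _]mulrC [q * _]mulrC.
  have sE vb : vb.1 = v -> \sum_u s vb u * (deg_in E [set: V]%SET u - mean_in [set: V]%SET u.1) =
      (-1) ^+ vb.2 * (#|nbrs E v|%:R - (N * p + N * q)).
    move=> vbv; rewrite (bigD1 v) //= big1 ?addr0 => [|u /negPf uv]; last by rewrite /s vbv uv mulr0 mul0r.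
    by rewrite /s vbv eqxx mulr1 dE mE.
  set dev := _ - _ in h sE.
  have [d0|d0] := lerP 0 dev.
    exists (v, false); rewrite sA sE //= expr0 mul1r mulr1.
    by apply: ltW; rewrite ger0_norm in h.
  exists (v, true); rewrite sA sE //= expr1 mulN1r mulr1.
  by apply: ltW; rewrite ltr0_norm in h.
apply: le_trans (sbm_pr_union _ _ _ _) _ => //.
apply: le_trans (_ : \sum_(vb : V * bool) expR (- (e ^+ 2 * (N * p) / 128)) <= _).
  apply: ler_sum => vb _.
  by apply: le_trans (sbm_linear_dev _ _ _ _ _) _ => //; rewrite sA mulr1.
rewrite sumr_const card_prod card_bool card_sbm_vertex -[leLHS]mulr_natl ler_wpM2r ?expR_ge0 //.
by rewrite -muln2 -mulnA natrM mulrC.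
Qed.

(** The total deviation equals a signed sum for the right sign vector, so a
    union bound over 4^n sets A and 4^n sign vectors suffices. *)
Lemma whp_good_cuts (e : R) : 0 < e -> e <= 1 -> 2 <= e * N ->
  Pg (fun E => ~ good_cuts e E) <= 16 ^+ n * expR (- (e ^+ 2 * (N * p) * N / 64)).
Proof.
move=> e0 e1 eN.
pose s (S : {set V}) v : R := if v \in S then 1 else -1.
have sS S v : `|s S v| = 1 by rewrite /s; case: ifP; rewrite ?normrN normr1.
have sA S : \sum_v `|s S v| = 2 * N.
  under eq_bigr do rewrite sS.
  by rewrite sumr_const card_sbm_vertex -mul2n natrM.
apply: le_trans (_ : Pg (fun E => exists AS : {set V} * {set V},
    e * (N * p) * \sum_v `|s AS.2 v| <=
    \sum_v s AS.2 v * (deg_in E AS.1 v - mean_in AS.1 v.1)) <= _).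
  apply: le_sbm_pr => // E _ /existsNP[A /negP]; rewrite -ltNge => h.
  exists (A, [set v | 0 <= deg_in E A v - mean_in A v.1]%SET) => /=.
  rewrite sA mulrC; apply: le_trans (ltW h) _.
  apply: ler_sum => v _; rewrite /s inE.
  by case: (lerP 0 (deg_in E A v - mean_in A v.1)) => d0; [rewrite mul1r ger0_norm|rewrite mulN1r ltr0_norm].
apply: le_trans (sbm_pr_union _ _ _ _) _ => //.
apply: le_trans (_ : \sum_(AS : {set V} * {set V}) expR (- (e ^+ 2 * (N * p) * N / 64)) <= _).
  apply: ler_sum => AS _.
  apply: le_trans (sbm_linear_dev _ _ _ _ _) _ => //; first by move=> v; rewrite sS.
  rewrite sA ler_expR; lra.
rewrite sumr_const card_prod -cardsT -powersetT card_powerset cardsT card_sbm_vertex.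
have -> : (2 ^ n.*2 * 2 ^ n.*2)%N = (16 ^ n)%N.
  by rewrite -expnD addnn -!muln2 -mulnA mulnC expnM.
by rewrite -[leLHS]mulr_natl natrX.
Qed.
End GoodGraph.

(** * Neighbourhoods of small sets in the random graph *)

(** A single term of the binomial expansion of (1 + x)^N, with (1 + x)^N <=
    exp(x N). *)
Lemma bin_le_expR (R : realType) (N s : nat) (x : R) : 0 < x ->
  'C(N, s)%:R <= expR (x * N%:R - s%:R * ln x).
Proof.
move=> x0.
have xs0 : 0 < x ^+ s by rewrite exprn_gt0.
have -> : expR (x * N%:R - s%:R * ln x) = expR (x * N%:R) / x ^+ s.
  by rewrite expRD expRN expRM_natl lnK.
rewrite ler_pdivlMr //.
apply: le_trans (_ : (1 + x) ^+ N <= _); last first.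
  rewrite mulrC expRM_natl lerXn2r ?nnegrE ?expR_ge0 ?expR_ge1Dx //; lra.
rewrite exprDn.
case: (ltnP N s) => sN.
  rewrite bin_small // mul0r; apply: sumr_ge0 => i _.
  by rewrite mulrn_wge0 // expr1n mul1r exprn_ge0 // ltW.
rewrite -ltnS in sN.
rewrite (bigD1 (Ordinal sN)) //= expr1n mul1r mulr_natl lerDl.
by apply: sumr_ge0 => i _; rewrite mulrn_wge0 // expr1n mul1r exprn_ge0 // ltW.
Qed.

Lemma sum_by_card (R : realType) (T : finType) (F : nat -> R) :
  \sum_(A : {set T}) F #|A| = \sum_(s < #|T|.+1) 'C(#|T|, s)%:R * F s.
Proof.
have bnd (A : {set T}) : (#|A| < #|T|.+1)%N by rewrite ltnS max_card.
rewrite (partition_big (fun A : {set T} => Ordinal (bnd A)) predT) //=.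
apply: eq_bigr => s _.
rewrite (eq_bigr (fun _ => F s)) => [|A /eqP <-//].
rewrite sumr_const -[LHS]mulr_natl -card_draws; congr (_%:R * _).
by apply: eq_card => A; rewrite [RHS]inE. 
Qed.

(** From exp(1/2) <= 2 and 2^8 = 256. *)
Lemma ln_ge4 (R : realType) (x : R) : 256 <= x -> 4 <= ln x.
Proof.
move=> hx; have x0 : 0 < x by lra.
rewrite -ler_expR lnK //; apply: le_trans hx.
have h := expR_le_quad (lexx (1/2 : R)).
have -> : (4 : R) = 8%:R * (1/2) by lra.
rewrite expRM_natl; apply: le_trans (_ : 2 ^+ 8 <= _); last by lra.
by rewrite lerXn2r ?nnegrE ?expR_ge0 //; lra.
Qed.

(** The numerical comparison at the end of [sparse_pair_dev], over plain real
    variables. *)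
Lemma sparse_exponent (R : realType) (m sq s L k lz y : R) :
  m * sq <= k -> s * sq <= k -> 4 <= L -> L <= 2 * lz -> 0 <= k ->
  y <= k / 2 -> - (lz / 2 * k) + y <= - (sq / 16 * (s + m) * L).
Proof.
move=> h1 h2 L4 Lz k0 hy.
have h4 : sq * (s + m) * L <= 2 * k * L by rewrite ler_wpM2r //; lra.
have h5 : k * (L / 4) <= k * (lz - 1) by rewrite ler_wpM2l //; lra.
lra.
Qed.

Section Sparse.
Context {R : realType} {n : nat} (p q : R).
Hypothesis q_ge0 : 0 <= q.
Hypothesis q_le_p : q <= p.
Hypothesis p_le1 : p <= 1.
Local Notation V := (sbm_vertex n).
Implicit Types (E : {set {set V}}) (A S : {set V}).
Local Notation Pg := (@sbm_pr R n p q).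
Local Notation N := (n%:R : R).
Local Notation D := (n%:R * p : R).

Definition root4_inv : R := (Num.sqrt (Num.sqrt D))^-1.
Local Notation eta := root4_inv.

(** The fraction of its neighbourhood beyond which a vertex counts as
    overexposed to a set of size s. The square root of s/n keeps the ratio to
    the mean exposure s/n at least sqrt(n/s), so that overexposure costs a
    logarithmic factor ln(n/s) in the exponent; the fourth root of 1/(np) keeps
    the exponent larger than the entropy of the choice of A even for tiny sets.
    *)
Definition exposure (s : nat) : R := Num.max (Num.sqrt (s%:R / N)) eta.

(** Few vertices are overexposed to A, uniformly in A: at most a proportion of
    #|A| that is itself small. *)
Definition good_exposure E :=
  forall A, (0 < #|A|)%N -> 256 * #|A|%:R <= N ->
   #|[set v | (exposure #|A| * D < deg_in E A v)%R]|%:R <= #|A|%:R * exposure #|A|.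

Hypothesis D_ge1 : 1 <= D.

Lemma eta_gt0 : 0 < eta.
Proof. by rewrite invr_gt0 !sqrtr_gt0; move: D_ge1; lra. Qed.

Lemma sqrtD_ge1 : 1 <= Num.sqrt D.
Proof. by rewrite -[X in X <= _]sqrtr1 ler_wsqrtr. Qed.

Lemma eta_sqr : eta ^+ 2 * D = Num.sqrt D.
Proof.
have h := sqrtD_ge1; move: D_ge1 => D1.
rewrite exprVn sqr_sqrtr; last lra.
rewrite -[X in _ * X](@sqr_sqrtr _ D); last lra.
by rewrite expr2 mulrA mulVf ?mul1r //; lra.
Qed.

Lemma eta_D : Num.sqrt D <= eta * D.
Proof.
have h := sqrtD_ge1; move: D_ge1 => D1; have e0 := eta_gt0.
rewrite -eta_sqr expr2 -mulrA ler_piMl //; first by rewrite mulr_ge0; lra.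
rewrite invf_le1 ?sqrtr_gt0; last lra.
by rewrite -[X in X <= _]sqrtr1 ler_wsqrtr.
Qed.

Lemma exposure_gt0 s : 0 < exposure s.
Proof. by rewrite /exposure lt_max eta_gt0 orbT. Qed.

Lemma exposure_sqr s : (0 < n)%N -> s%:R / N <= exposure s ^+ 2.
Proof.
move=> n0; have h : 0 <= s%:R / N by rewrite divr_ge0.
rewrite -[leLHS](sqr_sqrtr h) lerXn2r ?nnegrE ?sqrtr_ge0 ?(ltW (exposure_gt0 _)) //.
by rewrite le_max lexx.
Qed.

(** Tilt by z = b n / s, the ratio of the demanded number of edges to its mean.
    The gain per demanded edge is of order ln z, hence of order L = ln(n / s),
    and the number of demanded edges m b D is at least sqrt(D) times both #|A|
    and #|S|. *)
Lemma sparse_pair_dev A S : (0 < n)%N -> (0 < #|A|)%N -> 256 * #|A|%:R <= N ->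
  #|A|%:R * exposure #|A| <= #|S|%:R ->
  Pg (fun E => #|S|%:R * (exposure #|A| * D) <= \sum_(v in S) deg_in E A v) <=
  expR (- (Num.sqrt D / 16 * (#|A|%:R + #|S|%:R) * ln (N / #|A|%:R))).
Proof.
move=> n0 A0 AN bm; have N0 : 0 < N by rewrite ltr0n.
set s : R := #|A|%:R; set m : R := #|S|%:R; set b := exposure _.
have s0 : 0 < s by rewrite ltr0n.
have b0 : 0 < b := exposure_gt0 _.
set x := N / s; have x2 : 256 <= x by rewrite ler_pdivlMr.
have L4 := ln_ge4 x2; set L := ln x in L4 *.
(* b >= sqrt(s / n) says that the tilt is at least sqrt(n / s). *)
have bx : x <= (b * x) ^+ 2.
  have := exposure_sqr #|A| n0; rewrite -/b -/s => h.
  have xE : (s / N) * x ^+ 2 = x.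
    by rewrite /x; field; rewrite ?gt_eqF //; apply/andP; split; rewrite gt_eqF.
  rewrite -[leLHS]xE.
  by rewrite [leRHS]exprMn ler_wpM2r // sqr_ge0.
set z := b * x in bx *.
have x0 : 0 < x by rewrite divr_gt0.
have z0 : 0 < z by rewrite mulr_gt0.
have Lz : L <= 2 * ln z.
  by rewrite mulr_natl -lnXn // ler_ln // posrE exprn_gt0.
have t0 : 0 <= ln z / 2 by move: L4 Lz; clear; lra.
have h := adj_large q_ge0 q_le_p p_le1 S A (m * (b * D)) t0.
apply: le_trans (le_trans h _).
  apply: le_sbm_pr => // E _ h1.
  have -> : adj_sum (fun v u => ((v \in S) && (u \in A))%:R) E =
     adj_sum (fun v u => (v \in S)%:R * (u \in A)%:R : R) E.
    by apply: eq_bigr => v _; apply: eq_bigr => u _; rewrite -mulnb natrM.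
  rewrite adj_sum_deg; apply: le_trans h1 _.
  rewrite big_mkcond; apply: ler_sum => v _.
  by case: (v \in S); rewrite ?mul1r ?mul0r.
rewrite ler_expR [2 * (_ / 2)]mulrC divfK ?pnatr_eq0 // lnK // -/s -/m.
have zps : z * (p * s) = b * D by rewrite /z /x; field; rewrite gt_eqF.
have m0 : 0 <= m by [].
have hE := eta_D; have hE2 := eta_sqr; have e0 := eta_gt0.
have be : eta <= b by rewrite /b /exposure le_max lexx orbT.
have D0 : 0 < D by exact: lt_le_trans D_ge1.
have bD : Num.sqrt D <= b * D by apply: le_trans hE _; rewrite ler_wpM2r // ltW.
have h1 : m * Num.sqrt D <= m * (b * D) by rewrite ler_wpM2l.
have h2 : s * Num.sqrt D <= m * (b * D).
  apply: le_trans (_ : (s * b) * (b * D) <= _); last by rewrite ler_wpM2r // mulr_ge0 // ltW.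
  rewrite -mulrA ler_wpM2l ?(ltW s0) // mulrA -expr2 -hE2 ler_wpM2r ?(ltW D0) //.
  by rewrite lerXn2r ?nnegrE ?(ltW e0) ?(ltW b0).
have p0 : 0 <= p by exact: le_trans q_le_p.
have h3 : (z - 1) / 2 * (p * m * s) <= m * (b * D) / 2.
  have : 0 <= p * m * s by rewrite mulr_ge0 ?mulr_ge0 // ltW.
  have -> : m * (b * D) = z * (p * m * s) by rewrite -zps; ring.
  clear; lra.
apply: (sparse_exponent h1 h2 L4 Lz _ h3).
by rewrite mulr_ge0 // mulr_ge0 // ltW.
Qed.

(** If A violates the property, then the set S of overexposed vertices satisfies
    the event of [sparse_pair_dev]. There are at most exp(2 s L) sets of size s
    and exp(2 m L) sets S of size m, which sqrt(D)/16 >= 12 outweighs; finally s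
    ln(n/s) >= (ln n)/2 turns the exponent into a power of n. *)
Lemma whp_good_exposure : 200 <= Num.sqrt D -> (0 < n)%N ->
  Pg (fun E => ~ good_exposure E) <= 9 * N ^- 3.
Proof.
move=> D200 n0; have N0 : 0 < N by rewrite ltr0n.
pose c (s m : nat) := [&& (0 < s)%N, (256 * s%:R <= N)%R & (s%:R * exposure s <= m%:R)%R].
pose F (s m : nat) : R := if c s m then expR (- (Num.sqrt D / 16 * (s%:R + m%:R) * ln (N / s%:R))) else 0.
apply: le_trans (_ : Pg (fun E => exists AS : {set V} * {set V}, c #|AS.1| #|AS.2| /\
   #|AS.2|%:R * (exposure #|AS.1| * D) <= \sum_(v in AS.2) deg_in E AS.1 v) <= _).
  apply: le_sbm_pr => // E _ /existsNP[A] /not_implyP[A0] /not_implyP[AN] /negP.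
  rewrite -ltNge => h.
  exists (A, [set v | (exposure #|A| * D < deg_in E A v)%R]%SET); split => /=.
    by rewrite /c A0 AN ltW.
  rewrite -sum1_card natr_sum mulr_suml; apply: ler_sum => v; rewrite inE mul1r; exact: ltW.
apply: le_trans (sbm_pr_union _ _ _ _) _ => //.
apply: le_trans (_ : \sum_(AS : {set V} * {set V}) F #|AS.1| #|AS.2| <= _).
  apply: ler_sum => -[A S] _ /=; rewrite /F.
  case: ifP => [/and3P[h1 h2 h3]|cF].
    apply: le_trans (sparse_pair_dev n0 h1 h2 h3).
    by apply: le_sbm_pr => // E _ [].
  rewrite /sbm_pr big_pred0 // => E; apply/negbTE/negP => /andP[_ /asboolP[]].
  by [].
rewrite -(pair_big predT predT (fun A S : {set V} => F #|A| #|S|)) /=.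
under eq_bigr do rewrite (sum_by_card V (F _)).
rewrite (sum_by_card V (fun s => \sum_(m < #|{: V}|.+1) 'C(#|{: V}|, m)%:R * F s m)).
rewrite !card_sbm_vertex.
apply: le_trans (_ : \sum_(s < n.*2.+1) \sum_(m < n.*2.+1) N ^- 5 <= _).
  apply: ler_sum => s _; rewrite mulr_sumr; apply: ler_sum => m _.
  rewrite /F; case: ifP => [/and3P[s0 sN sm]|_]; last by rewrite !mulr0 invr_ge0 exprn_ge0.
  move: sm sN s0; move: (nat_of_ord s) (nat_of_ord m) => {}s {}m sm sN s0.
  have s0' : 0 < s%:R :> R by rewrite ltr0n.
  have m0' : 0 < m%:R :> R by apply: lt_le_trans sm; rewrite mulr_gt0 // exposure_gt0.
  have b1 := @bin_le_expR R n.*2 s (s%:R / N) (divr_gt0 s0' N0).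
  have b2 := @bin_le_expR R n.*2 m (m%:R / N) (divr_gt0 m0' N0).
  set L := ln (N / s%:R).
  have L4 : 4 <= L by apply: ln_ge4; rewrite ler_pdivlMr.
  have dbl (y : R) : y / N * (n.*2)%:R = 2 * y.
    by rewrite -mul2n natrM; field; rewrite gt_eqF.
  rewrite dbl -[s%:R / N]invf_div lnV ?posrE ?divr_gt0 // -/L in b1.
  rewrite dbl -[m%:R / N]invf_div lnV ?posrE ?divr_gt0 // in b2.
  set Lm := ln (N / m%:R) in b2.
  have Lm3 : 2 * Lm <= 3 * L.
    rewrite /Lm /L mulr_natl [leRHS]mulr_natl -!lnXn ?divr_gt0 // ler_ln ?posrE ?exprn_gt0 ?divr_gt0 //.
    have hs := exposure_sqr s n0.
    have : s%:R ^+ 3 <= m%:R ^+ 2 * N.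
      apply: le_trans (_ : (s%:R * exposure s) ^+ 2 * N <= _).
        have h0 : s%:R <= exposure s ^+ 2 * N by rewrite -ler_pdivrMr.
        by rewrite exprSr exprMn -[leRHS]mulrA ler_wpM2l ?exprn_ge0.
      rewrite ler_wpM2r ?(ltW N0) // lerXn2r ?nnegrE ?(ltW m0') // mulr_ge0 ?(ltW s0') //.
      exact: ltW (exposure_gt0 _).
    move=> h; rewrite !expr_div_n ler_pdivrMr ?exprn_gt0 // mulrAC ler_pdivlMr ?exprn_gt0 //.
    apply: le_trans (ler_wpM2l (exprn_ge0 2 (ltW N0)) h) _.
    by rewrite le_eqVlt; apply/orP; left; apply/eqP; ring.
  (* For s <= sqrt n the logarithm L is at least half of ln n; for larger s the
     factor s alone exceeds it. *)
  have sL : ln N <= 2 * (s%:R * L).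
    have s1 : 1 <= s%:R :> R by rewrite ler1n.
    have lnE : L = ln N - ln s%:R by rewrite /L ln_div // posrE.
    case: (lerP (s%:R ^+ 2) N) => hsN.
      have h : ln (s%:R ^+ 2) <= ln N by rewrite ler_ln ?posrE ?exprn_gt0.
      rewrite lnXn // -[leLHS]mulr_natl in h.
      have : 1 * L <= s%:R * L by rewrite ler_wpM2r //; lra.
      lra.
    have h : ln N <= ln (s%:R ^+ 2) by rewrite ler_ln ?posrE ?exprn_gt0 // ltW.
    rewrite lnXn // -[leRHS]mulr_natl in h.
    have := ln_sublinear s0'.
    have : s%:R * 1 <= s%:R * L by rewrite ler_wpM2l //; lra.
    lra.
  apply: le_trans (_ : expR (2 * s%:R - s%:R * - L) * (expR (2 * m%:R - m%:R * - Lm) *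
     expR (- (Num.sqrt D / 16 * (s%:R + m%:R) * L))) <= _).
    by rewrite ler_pM ?mulr_ge0 ?expR_ge0 // ler_wpM2r ?expR_ge0.
  have -> : N ^- 5 = expR (- (5%:R * ln N)) by rewrite expRN expRM_natl lnK.
  rewrite -!expRD ler_expR.
  set K := Num.sqrt D / 16; have K12 : 12 <= K by rewrite /K; lra.
  have m0 := ltW m0'.
  have i1 : m%:R * (2 * Lm) <= m%:R * (3 * L) by rewrite ler_wpM2l.
  have i2 : m%:R * 4 <= m%:R * L by rewrite ler_wpM2l.
  have i3 : s%:R * 4 <= s%:R * L by rewrite ler_wpM2l // ltW.
  have i4 : 12 * ((s%:R + m%:R) * L) <= K * ((s%:R + m%:R) * L).
    by rewrite ler_wpM2r // mulr_ge0 ?addr_ge0 ?(ltW s0') //; lra.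
  have i5 : 0 <= m%:R * L by rewrite mulr_ge0 //; lra.
  lra.
under eq_bigr do rewrite sumr_const card_ord.
rewrite sumr_const card_ord -mulrnA -[leLHS]mulr_natl.
have -> : N ^- 5 = N ^- 2 * N ^- 3 by rewrite -invfM -exprD.
rewrite mulrA; apply: ler_wpM2r; first by rewrite invr_ge0 exprn_ge0.
rewrite ler_pdivrMr ?exprn_gt0 // -natrX -natrM ler_nat.
have -> : (9 * n ^ 2 = (3 * n) * (3 * n))%N by rewrite mulnACA.
have h : (n.*2.+1 <= 3 * n)%N by rewrite -addnn !mulSn mul0n addn0 addnA -addn1 leq_add2l.
by rewrite leq_mul.
Qed.
End Sparse.

(** * One round on a typical graph *)

(** The mean-field map in the coordinates delta (half the sum of the two block
    magnetisations) and gamma (half their difference); u measures how much a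
    vertex prefers its own block. *)
Definition next_delta (R : realType) (u d g : R) : R :=
  d * (3 - d ^+ 2 - (u ^+ 2 + 2 * u) * g ^+ 2) / 2.
Definition next_gamma (R : realType) (u d g : R) : R :=
  g * (1 + 2 * u - u ^+ 2 * g ^+ 2 - (1 + 2 * u) * d ^+ 2) / 2.

Lemma nbrs_sym (V : finType) (E : {set {set V}}) (u v : V) :
  (u \in nbrs E v) = (v \in nbrs E u).
Proof. by rewrite !inE eq_sym finset.setUC. Qed.

Section Good.
Context {R : realType} {n : nat} (p q : R).
Local Notation V := (sbm_vertex n).
Implicit Types (E : {set {set V}}) (A S : {set V}).
Local Notation Pg := (@sbm_pr R n p q).
Local Notation N := (n%:R : R).
Local Notation D := (n%:R * p : R).

Definition good_graph e E :=
  [/\ good_degrees p q e E, good_cuts p q e E & good_exposure p E].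

Lemma whp_good_graph (e : R) : 0 <= q -> q <= p -> p <= 1 ->
  0 < e -> e <= 1 -> 2 <= e * N -> 14 <= N ->
  384 * ln N <= e ^+ 2 * D -> 384 <= e ^+ 2 * D -> 200 <= Num.sqrt D ->
  1 - N^-1 <= Pg (good_graph e).
Proof.
move=> q0 qp p1 e0 e1 eN N14 DlnN D384 D200.
have n0 : (0 < n)%N by rewrite -(ltr0n R); lra.
have N0 : 0 < N by rewrite ltr0n.
have D1 : 1 <= D.
  rewrite -(@ler_sqrt _ 1) ?sqrtr1; last first.
    by rewrite leNgt; apply/negP => h; move: D200; rewrite ltr0_sqrtr //; lra.
  by apply: le_trans D200; lra.
apply: le_trans (_ : 1 - Pg (fun E => (~ good_degrees p q e E \/ ~ good_cuts p q e E) \/ ~ good_exposure p E) <= _); last first.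
  apply: sbm_pr_compl => // E _ h; split; apply: contrapT => h'; apply: h; tauto.
rewrite lerB //.
apply: le_trans (sbm_prU _ _ _ _ _) _ => //.
apply: le_trans (lerD (sbm_prU q0 qp p1 _ _) (whp_good_exposure q0 qp p1 D1 D200 n0)) _.
apply: le_trans (lerD (lerD (whp_good_degrees q0 qp p1 e0 e1 eN) (whp_good_cuts q0 qp p1 e0 e1 eN)) (lexx _)) _.
have h1 : expR (- (e ^+ 2 * D / 128)) <= N ^- 3.
  rewrite -[N ^- 3]lnK ?posrE ?invr_gt0 ?exprn_gt0 // ler_expR lnV ?posrE ?exprn_gt0 // lnXn // -[ln N *+ 3]mulr_natl.
  by rewrite lerN2; lra.
have h2 : 16 ^+ n * expR (- (e ^+ 2 * D * N / 64)) <= N ^- 2.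
  have h2e : 2 <= expR 1 :> R by have := expR_ge1Dx (1 : R); lra.
  have h16 : 16 <= expR 4 :> R.
    have -> : 4 = 4%:R * 1 :> R by rewrite mulr1.
    rewrite expRM_natl; have -> : 16 = 2 ^+ 4 :> R by ring.
    by rewrite lerXn2r ?nnegrE ?expR_ge0.
  apply: le_trans (_ : expR 4 ^+ n * expR (- (e ^+ 2 * D * N / 64)) <= _).
    by rewrite ler_wpM2r ?expR_ge0 // lerXn2r ?nnegrE ?expR_ge0.
  rewrite -expRM_natl -expRD.
  have -> : N ^- 2 = expR (- (2%:R * ln N)) by rewrite expRN expRM_natl lnK.
  rewrite ler_expR; have := ln_sublinear N0.
  have : 384 * N <= e ^+ 2 * D * N by rewrite ler_wpM2r // ltW.
  lra.
apply: le_trans (_ : 4 * N * N ^- 3 + N ^- 2 + 9 * N ^- 3 <= _).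
  by rewrite lerD2r lerD // ler_wpM2l // mulr_ge0 // ltW.
have -> : 4 * N * N ^- 3 = 4 * N ^- 2 by field; rewrite gt_eqF.
have h3 : N ^- 3 <= N ^- 2.
  by rewrite lef_pV2 ?posrE ?exprn_gt0 // ler_eXn2l //; lra.
have : 14 * N ^- 2 <= N^-1.
  have -> : 14 * N ^- 2 = (14 / N) * N^-1 by field; rewrite gt_eqF.
  by rewrite ler_piMl ?invr_ge0 ?(ltW N0) // ler_pdivrMr // mul1r.
lra.
Qed.

Variable e : R.
Hypothesis e_gt0 : 0 < e.
Hypothesis e_le : e <= 1/2.
Hypothesis q_ge0 : 0 <= q.
Hypothesis q_le_p : q <= p.
Hypothesis D_ge1 : 1 <= D.
Variable E : {set {set V}}.
Hypothesis gE : good_graph e E.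

Let n0 : (0 < n)%N.
Proof.
rewrite lt0n; apply/negP => /eqP n00; move: D_ge1.
by rewrite n00 mul0r ler10.
Qed.

Let N0 : 0 < N. Proof. by rewrite ltr0n. Qed.

Let Nq0 : 0 <= N * q. Proof. exact: mulr_ge0. Qed.

Let NqD : N * q <= D. Proof. by rewrite ler_wpM2l. Qed.

Lemma good_deg_ge v : D / 2 <= #|nbrs E v|%:R.
Proof.
have [/(_ v) h _ _] := gE; move: h Nq0 D_ge1 e_le.
rewrite ler_norml => /andP[h _] h1 h2 h3.
have : e * D <= (1/2) * D by rewrite ler_wpM2r //; lra.
lra.
Qed.

Lemma good_deg_le v : #|nbrs E v|%:R <= 5/2 * D.
Proof.
have [/(_ v) h _ _] := gE; move: h Nq0 NqD D_ge1 e_le.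
rewrite ler_norml => /andP[_ h] h1 h2 h3 h4.
have : e * D <= (1/2) * D by rewrite ler_wpM2r //; lra.
lra.
Qed.

Lemma good_pollees v : pollees E v = nbrs E v.
Proof.
rewrite /pollees; case: eqP => // h.
exfalso; have := good_deg_ge v; rewrite h cards0; move: D_ge1; clear h; lra.
Qed.

Lemma good_vote_frac A v : vote_frac E A v = deg_in E A v / #|nbrs E v|%:R :> R.
Proof. by rewrite /vote_frac good_pollees. Qed.

Lemma sum_deg_in A : \sum_v deg_in E A v = \sum_(u in A) #|nbrs E u|%:R :> R.
Proof.
transitivity (\sum_v \sum_(u in A) (u \in nbrs E v)%:R : R).
  apply: eq_bigr => v _; rewrite /deg_in -sum1_card natr_sum big_mkcond [RHS]big_mkcond.
  by apply: eq_bigr => u _; rewrite inE; case: (u \in A); rewrite ?andbF ?andbT //; case: ifP.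
rewrite exchange_big /=; apply: eq_bigr => u _.
rewrite -sum1_card natr_sum [RHS]big_mkcond; apply: eq_bigr => v _.
by rewrite nbrs_sym; case: ifP.
Qed.

(** A holder of opinion 1 keeps it with probability at most 2y + y^2 and another
    vertex gains it with probability y^2, where y is the fraction of opinion 1
    among its neighbours. This y is at most 2b except on the few overexposed
    vertices, and the sum of y over all vertices is of order #|A| by double
    counting. *)
Lemma sum_adopt_nonempty A : (0 < #|A|)%N -> 256 * #|A|%:R <= N ->
  \sum_v adopt E A v <= 20 * (@exposure R n p #|A| * #|A|%:R) :> R.
Proof.
move=> A0 A256; have [_ _ gs] := gE.
have := gs A A0 A256; set b := @exposure R n p #|A|; set s := #|A|%:R => hbad.
have b0 : 0 < b by apply: exposure_gt0.
have s0 : 0 < s by rewrite ltr0n.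
have D0 : 0 < D by exact: lt_le_trans D_ge1.
set bad := [set v | _] in hbad.
pose y v : R := vote_frac E A v.
have y0 v : 0 <= y v by exact: vote_frac_ge0.
have y1 v : y v <= 1 by exact: vote_frac_le1.
have yd v : y v <= 2 / D * deg_in E A v.
  rewrite /y good_vote_frac mulrC ler_wpM2r //.
  have := good_deg_ge v => h.
  have d2 : 0 < D / 2 by rewrite divr_gt0.
  rewrite -[2 / D]invf_div lef_pV2 ?posrE //; exact: lt_le_trans h.
have yb v : y v <= 2 * b + (v \in bad)%:R.
  rewrite inE; case: ltP => h /=; first by apply: le_trans (y1 v) _; lra.
  rewrite addr0; apply: le_trans (yd v) _.
  apply: le_trans (ler_wpM2l _ h) _; first by rewrite divr_ge0 // ltW.
  by rewrite [b * D]mulrC mulrA divfK ?gt_eqF.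
have sumbad : \sum_v (v \in bad)%:R = #|bad|%:R :> R.
  by rewrite -sum1_card natr_sum [RHS]big_mkcond; apply: eq_bigr => v _; case: ifP.
have sumy : \sum_v y v <= 5 * s.
  apply: le_trans (_ : \sum_v 2 / D * deg_in E A v <= _); first exact: ler_sum.
  rewrite -mulr_sumr sum_deg_in.
  apply: le_trans (_ : 2 / D * \sum_(u in A) (5/2 * D) <= _).
    rewrite ler_wpM2l ?divr_ge0 ?(ltW D0) //; apply: ler_sum => u _; exact: good_deg_le.
  rewrite sumr_const -[X in _ * X]mulr_natr -/s mulrA [5 / 2 * D]mulrC mulrA divfK ?gt_eqF //; lra.
have sumyA : \sum_(v in A) y v <= 3 * (b * s).
  apply: le_trans (_ : \sum_(v in A) (2 * b) + \sum_v (v \in bad)%:R <= _).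
    apply: le_trans (_ : \sum_(v in A) (2 * b + (v \in bad)%:R) <= _); first exact: ler_sum.
    rewrite big_split lerD //= big_mkcond; apply: ler_sum => v _.
    by case: ifP.
  by rewrite sumr_const sumbad -mulr_natr -/s; lra.
have sumy2 : \sum_v y v ^+ 2 <= 11 * (b * s).
  apply: le_trans (_ : \sum_v (2 * b * y v + (v \in bad)%:R) <= _).
    apply: ler_sum => v _; have := y0 v; have := y1 v; have := yb v.
    by case: (v \in bad) => /=; nra.
  rewrite big_split /= -mulr_sumr sumbad.
  have := ler_wpM2l (ltW b0) sumy; lra.
apply: le_trans (_ : \sum_v ((if v \in A then 2 * y v else 0) + y v ^+ 2) <= _).
  apply: ler_sum => v _; rewrite /adopt -/(y v); case: ifP => _; last by rewrite add0r.
  have := y0 v; nra.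
rewrite big_split /= -big_mkcond -mulr_sumr.
have : 0 <= b * s by rewrite mulr_ge0 // ltW.
lra.
Qed.

Variable r : R.
Hypothesis r_ge0 : 0 <= r.
Hypothesis qE : q = r * p.

Definition block_frac A i : R := #|A :&: block n i|%:R / N.
(** The fraction of opinion 1 among the neighbours of a vertex of block i in an
    ideal graph. *)
Definition seen_frac A i : R := (block_frac A i + r * block_frac A (~~ i)) / (1 + r).
(** The fraction of opinion 1 in block i after one round in an ideal graph. *)
Definition next_frac A i : R :=
  block_frac A i * (1 - (1 - seen_frac A i) ^+ 2) + (1 - block_frac A i) * seen_frac A i ^+ 2.

Lemma block_frac_ge0 A i : 0 <= block_frac A i.
Proof. by rewrite divr_ge0. Qed.

Lemma block_frac_le1 A i : block_frac A i <= 1.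
Proof. by rewrite ler_pdivrMr // mul1r card_cap_block_le. Qed.

Lemma seen_frac_bounds A i : 0 <= seen_frac A i <= 1.
Proof.
have r1 : 0 < 1 + r by move: r_ge0; lra.
rewrite /seen_frac divr_ge0 ?addr_ge0 ?mulr_ge0 ?block_frac_ge0 ?(ltW r1) //=.
rewrite ler_pdivrMr // mul1r lerD ?block_frac_le1 //.
by rewrite ler_piMr ?block_frac_le1.
Qed.

Lemma seen_fracE A i : seen_frac A i = mean_in p q A i / ((1 + r) * D).
Proof.
have r1 : 0 < 1 + r by move: r_ge0; lra.
have D0 : 0 < D by exact: lt_le_trans D_ge1.
have p0 : p != 0 by apply/eqP => p0; move: D0; rewrite p0 mulr0 ltxx.
rewrite /seen_frac /mean_in /block_frac qE; field.
by rewrite p0 !gt_eqF.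
Qed.

(** Replacing the true neighbourhood fraction by the ideal one costs e for the
    denominator (degrees) and the cut deviation for the numerator. *)
Lemma sum_vote_frac_dev A : \sum_v `|vote_frac E A v - seen_frac A v.1| <= 4 * e * N.
Proof.
have [gd gc _] := gE.
have r1 : 0 < 1 + r by move: r_ge0; lra.
have D0 : 0 < D by exact: lt_le_trans D_ge1.
have key (a b c f : R) : b != 0 -> f != 0 -> a / b - c / f = (a / b) * ((f - b) / f) + (a - c) / f.
  by move=> b0 f0; field; rewrite b0 f0.
apply: le_trans (_ : \sum_(v : V) (e + `|deg_in E A v - mean_in p q A v.1| / D) <= _).
  apply: ler_sum => v _; rewrite good_vote_frac seen_fracE.
  set d := #|nbrs E v|%:R; set x := deg_in E A v; set m := mean_in _ _ _ _.
  have d0 : 0 < d by apply: lt_le_trans (good_deg_ge v); rewrite divr_gt0.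
  have D00 : 0 < (1 + r) * D by rewrite mulr_gt0.
  have DD0 : D <= (1 + r) * D by rewrite ler_peMl ?(ltW D0) //; move: r_ge0; lra.
  have -> : x / d - m / ((1 + r) * D) =
     (x / d) * (((1 + r) * D - d) / ((1 + r) * D)) + (x - m) / ((1 + r) * D).
    exact: key (lt0r_neq0 d0) (lt0r_neq0 D00).
  have xd : 0 <= x / d <= 1.
    rewrite divr_ge0 ?(ltW d0) //= ler_pdivrMr // mul1r ler_nat.
    by rewrite subset_leq_card // finset.subsetIl.
  case/andP: xd => xd0 xd1.
  apply: le_trans (ler_normD _ _) _; apply: lerD.
    rewrite normrM ger0_norm //; apply: le_trans (ler_piMl (normr_ge0 _) xd1) _.
    rewrite normrM normfV (gtr0_norm D00) ler_pdivrMr //.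
    rewrite distrC; have := gd v; rewrite -/d.
    have -> : D + N * q = (1 + r) * D by rewrite qE; ring.
    move=> /le_trans; apply; rewrite ler_wpM2l // ltW //.
  rewrite normrM normfV (gtr0_norm D00) ler_wpM2l // lef_pV2 //.
rewrite big_split /= sumr_const card_sbm_vertex -mulr_suml -[e *+ _]mulr_natl -mul2n natrM.
have : (\sum_v `|deg_in E A v - mean_in p q A v.1|) / D <= 2 * N * e.
  rewrite ler_pdivrMr //; apply: le_trans (gc A) _.
  by rewrite le_eqVlt; apply/orP; left; apply/eqP; ring.
lra.
Qed.

(** The adoption probability is 2-Lipschitz in the neighbourhood fraction. *)
Lemma next_frac_dev A i :
  `|\sum_(v in block n i) adopt E A v - N * next_frac A i| <= 8 * e * N.
Proof.
have -> : N * next_frac A i = \sum_(v in block n i)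
    (if v \in A then 1 - (1 - seen_frac A v.1) ^+ 2 else seen_frac A v.1 ^+ 2).
  rewrite (bigID (fun v => v \in A)) /=.
  rewrite (eq_bigr (fun _ => 1 - (1 - seen_frac A i) ^+ 2)); last first.
    by move=> v; rewrite inE => /andP[/eqP -> ->].
  rewrite [X in _ + X](eq_bigr (fun _ => seen_frac A i ^+ 2)); last first.
    by move=> v; rewrite inE => /andP[/eqP -> /negPf ->].
  rewrite !sumr_const -[X in _ = X + _]mulr_natl -[X in _ = _ + X]mulr_natl.
  have -> : #|[pred v | (v \in block n i) && (v \in A)]| = #|A :&: block n i|.
    by apply: eq_card => v; rewrite !inE andbC.
  have -> : #|[pred v | (v \in block n i) && (v \notin A)]|%:R = N - #|A :&: block n i|%:R :> R.
    have hN : N = #|A :&: block n i|%:R + #|block n i :\: A|%:R.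
      by rewrite -natrD finset.setIC cardsID card_block.
    rewrite hN addrAC subrr add0r; congr (_%:R).
    by apply: eq_card => v; rewrite !inE andbC.
  rewrite /next_frac /block_frac; field; rewrite gt_eqF //.
rewrite -sumrB; apply: le_trans (ler_norm_sum _ _ _) _.
apply: le_trans (_ : \sum_(v in block n i) 2 * `|vote_frac E A v - seen_frac A v.1| <= _).
  apply: ler_sum => v _; rewrite /adopt.
  have a0 := vote_frac_ge0 (R := R) E A v; have a1 := vote_frac_le1 (R := R) E A v.
  have /andP[] := seen_frac_bounds A v.1.
  set x := vote_frac _ _ _ in a0 a1 *; set y := seen_frac _ _ => y0 y1.
  case: ifP => _.
    have -> : 1 - (1 - x) ^+ 2 - (1 - (1 - y) ^+ 2) = (2 - x - y) * (x - y) by ring.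
    rewrite normrM ler_wpM2r // ger0_norm; lra.
  have -> : x ^+ 2 - y ^+ 2 = (x + y) * (x - y) by ring.
  rewrite normrM ler_wpM2r // ger0_norm; lra.
rewrite -mulr_sumr.
have := sum_vote_frac_dev A => h.
have : \sum_(v in block n i) `|vote_frac E A v - seen_frac A v.1| <=
   \sum_v `|vote_frac E A v - seen_frac A v.1|.
  by rewrite [leLHS]big_mkcond; apply: ler_sum => v _; case: ifP.
lra.
Qed.

Definition delta A : R := block_frac A true + block_frac A false - 1.
Definition gamma A : R := block_frac A true - block_frac A false.
Definition assortativity : R := (1 - r) / (1 + r).

Lemma next_frac_delta A :
  next_frac A true + next_frac A false - 1 = next_delta assortativity (delta A) (gamma A).
Proof.
have r1 : 1 + r != 0 by apply: lt0r_neq0; move: r_ge0; lra.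
rewrite /next_frac /seen_frac /next_delta /assortativity /delta /gamma /=.
by field.
Qed.

Lemma next_frac_gamma A :
  next_frac A true - next_frac A false = next_gamma assortativity (delta A) (gamma A).
Proof.
have r1 : 1 + r != 0 by apply: lt0r_neq0; move: r_ge0; lra.
rewrite /next_frac /seen_frac /next_gamma /assortativity /delta /gamma /=.
by field.
Qed.

Definition near_state (eps d g : R) : pred {set V} :=
  fun B => (`|delta B - d| <= eps) && (`|gamma B - g| <= eps).

(** One round follows the mean-field map up to 18 e: each block fraction errs by
    8e for the graph and e for the vote, and delta and gamma add up two of them.
    *)
Lemma vote_step_near A :
  vote_prob E 1 (fun B => ~~ near_state (18 * e)
    (next_delta assortativity (delta A) (gamma A)) (next_gamma assortativity (delta A) (gamma A)) B) A
  <= 4 * expR (- (e ^+ 2 * N / 8)).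
Proof.
have eb i := vote_chernoff E A (S := block n i) (N := N) (e := e).
have e1 : e <= 1 by move: e_le; lra.
have hN i : #|block n i|%:R <= N by rewrite card_block.
have {}eb i := eb i (hN i) (ltW e_gt0) e1.
have := lerD (eb true) (eb false); rewrite -vote_stepD => h.
apply: le_trans (le_trans h _); last by rewrite le_eqVlt; apply/orP; left; apply/eqP; ring.
apply: le_vote_step => B.
have bl i : `|#|B :&: block n i|%:R - \sum_(v in block n i) adopt E A v| < e * N ->
    `|block_frac B i - next_frac A i| <= 9 * e.
  move=> h1; have h2 := next_frac_dev A i.
  rewrite -(ler_pM2r N0) -{1}(gtr0_norm N0) -normrM mulrBl divfK ?gt_eqF // [next_frac _ _ * _]mulrC.
  apply: le_trans (ler_distD (\sum_(v in block n i) adopt E A v) _ _) _.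
  lra.
case: (lerP (e * N) `|#|B :&: block n true|%:R - _|) => [_|/bl ht].
  by rewrite -natrD ler_nat; apply: leq_trans (leq_b1 _) _.
case: (lerP (e * N) `|#|B :&: block n false|%:R - _|) => [_|/bl hf].
  by rewrite add0r ler_nat leq_b1.
rewrite addr0 -next_frac_delta -next_frac_gamma.
suff -> : near_state (18 * e) (next_frac A true + next_frac A false - 1)
   (next_frac A true - next_frac A false) B by [].
rewrite /near_state /delta /gamma; apply/andP; split.
  have -> : block_frac B true + block_frac B false - 1 - (next_frac A true + next_frac A false - 1) =
    (block_frac B true - next_frac A true) + (block_frac B false - next_frac A false) by ring.
  apply: le_trans (ler_normD _ _) _; lra.
have -> : block_frac B true - block_frac B false - (next_frac A true - next_frac A false) =
    (block_frac B true - next_frac A true) - (block_frac B false - next_frac A false) by ring.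
apply: le_trans (ler_normB _ _) _; lra.
Qed.
End Good.

(** * The mean-field map *)

(** Turns a geometric decay into a number of rounds that depends only on the
    constants. *)
Lemma expr_small (R : realType) (rho B eps : R) : 0 <= rho -> rho < 1 -> 0 < eps ->
  exists k, rho ^+ k * B <= eps.
Proof.
move=> r0 r1 e0.
have h : `|rho| < 1 by rewrite ger0_norm.
have B1 : 0 < `|B| + 1 by rewrite ltr_wpDl.
have /cvgr0Pnorm_le /(_ (eps / (`|B| + 1))) := cvg_expr h.
rewrite divr_gt0 // => /(_ isT) [k _ /(_ k (leqnn _)) /=].
rewrite ger0_norm ?exprn_ge0 // => hk; exists k.
apply: le_trans (_ : rho ^+ k * (`|B| + 1) <= _); last by rewrite -ler_pdivlMr.
rewrite ler_wpM2l ?exprn_ge0 //; apply: le_trans (ler_norm _) _; lra.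
Qed.

Section MeanField.
Context {R : realType} (u : R).
Implicit Types d g : R.
Local Notation Fd := (next_delta u).
Local Notation Fg := (next_gamma u).

(** The states that come from block fractions in [0,1]: their sum and difference
    are the magnetisations of the two blocks. *)
Definition in_domain d g := [/\ -1 <= d + g, d + g <= 1, -1 <= d - g & d - g <= 1].

Lemma in_domain_sqr d g : in_domain d g -> d ^+ 2 + g ^+ 2 <= 1.
Proof. case=> h1 h2 h3 h4; nra. Qed.

(** The new magnetisation of a block with magnetisation a whose vertices see
    magnetisation x; it stays in [-1,1] because (1 - |x|)^2 >= 0. *)
Lemma majority_bound (a x : R) : -1 <= a -> a <= 1 -> -1 <= x -> x <= 1 ->
  -1 <= x + a * (1 - x ^+ 2) / 2 <= 1.
Proof.
move=> a0 a1 x0 x1.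
have s0 : 0 <= 1 - x ^+ 2 by nra.
have h1 : a * (1 - x ^+ 2) <= 1 * (1 - x ^+ 2) by rewrite ler_wpM2r.
have h2 : -1 * (1 - x ^+ 2) <= a * (1 - x ^+ 2) by rewrite ler_wpM2r.
apply/andP; split; nra.
Qed.

Lemma in_domain_next d g : 0 <= u -> u <= 1 -> in_domain d g -> in_domain (Fd d g) (Fg d g).
Proof.
move=> u0 u1 [h1 h2 h3 h4].
have x1 : -1 <= d + u * g <= 1 by apply/andP; split; nra.
have x2 : -1 <= d - u * g <= 1 by apply/andP; split; nra.
case/andP: x1 => x1 x1'; case/andP: x2 => x2 x2'.
have /andP[a1 a2] := majority_bound h1 h2 x1 x1'.
have /andP[b1 b2] := majority_bound h3 h4 x2 x2'.
have e1 : Fd d g + Fg d g = d + u * g + (d + g) * (1 - (d + u * g) ^+ 2) / 2.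
  by rewrite /next_delta /next_gamma; field.
have e2 : Fd d g - Fg d g = d - u * g + (d - g) * (1 - (d - u * g) ^+ 2) / 2.
  by rewrite /next_delta /next_gamma; field.
by split; rewrite ?e1 ?e2.
Qed.

Lemma mul_dist_le (a b a' b' h k : R) : `|a| <= 1 -> `|b'| <= 1 ->
  `|a - a'| <= h -> `|b - b'| <= k -> `|a * b - a' * b'| <= h + k.
Proof.
move=> a1 b1 h1 h2.
have -> : a * b - a' * b' = b' * (a - a') + a * (b - b') by ring.
apply: le_trans (ler_normD _ _) _; rewrite !normrM; apply: lerD.
  by apply: le_trans h1; rewrite ler_piMl.
by apply: le_trans h2; rewrite ler_piMl.
Qed.

Lemma norm_mul_le1 (a b : R) : `|a| <= 1 -> `|b| <= 1 -> `|a * b| <= 1.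
Proof. by move=> a1 b1; rewrite normrM mulr_ile1. Qed.

Lemma mean_field_lipschitz d g d' g' h : 0 <= u -> u <= 1 ->
  `|d| <= 1 -> `|g| <= 1 -> `|d'| <= 1 -> `|g'| <= 1 ->
  `|d - d'| <= h -> `|g - g'| <= h ->
  `|Fd d g - Fd d' g'| <= 8 * h /\ `|Fg d g - Fg d' g'| <= 8 * h.
Proof.
move=> u0 u1 d1 g1 d1' g1' hd hg.
have h0 : 0 <= h by apply: le_trans hd.
have p3 x y x' y' : `|x| <= 1 -> `|y| <= 1 -> `|x'| <= 1 -> `|y'| <= 1 ->
   `|x - x'| <= h -> `|y - y'| <= h -> `|x * y ^+ 2 - x' * y' ^+ 2| <= 3 * h.
  move=> x1 y1 x1' y1' hx hy.
  have := mul_dist_le x1 (norm_mul_le1 y1' y1') hx (mul_dist_le y1 y1' hy hy).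
  by rewrite -!expr2 => /le_trans; apply; lra.
have a1 := p3 _ _ _ _ d1 d1 d1' d1' hd hd.
have a2 := p3 _ _ _ _ d1 g1 d1' g1' hd hg.
have a3 := p3 _ _ _ _ g1 g1 g1' g1' hg hg.
have a4 := p3 _ _ _ _ g1 d1 g1' d1' hg hd.
have u2 : 0 <= u ^+ 2 <= 1 by apply/andP; split; nra.
have hu c x b : 0 <= c -> c <= b -> `|x| <= 3 * h -> `|c * x| <= b * (3 * h).
  by move=> c0 cb hx; rewrite normrM (ger0_norm c0) ler_pM.
split.
  have -> : Fd d g - Fd d' g' = 3/2 * (d - d') - 1/2 * (d * d ^+ 2 - d' * d' ^+ 2)
      - (u ^+ 2 + 2 * u) / 2 * (d * g ^+ 2 - d' * g' ^+ 2).
    by rewrite /next_delta; field.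
  have b3 : `|(u ^+ 2 + 2 * u) / 2 * (d * g ^+ 2 - d' * g' ^+ 2)| <= 3/2 * (3 * h).
    by apply: hu => //; lra.
  move: hd a1 b3; rewrite !ler_norml; set x1 := d - d'; set x2 := d * d ^+ 2 - _; set x3 := _ * (_ - _).
  by move=> /andP[? ?] /andP[? ?] /andP[? ?]; apply/andP; split; lra.
have -> : Fg d g - Fg d' g' = (1 + 2 * u) / 2 * (g - g') - u ^+ 2 / 2 * (g * g ^+ 2 - g' * g' ^+ 2)
      - (1 + 2 * u) / 2 * (g * d ^+ 2 - g' * d' ^+ 2).
  by rewrite /next_gamma; field.
have b1 : `|(1 + 2 * u) / 2 * (g - g')| <= 3/2 * h.
  by rewrite normrM ger0_norm ?ler_pM //; lra.
have b2 : `|u ^+ 2 / 2 * (g * g ^+ 2 - g' * g' ^+ 2)| <= 1/2 * (3 * h) by apply: hu => //; lra.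
have b3 : `|(1 + 2 * u) / 2 * (g * d ^+ 2 - g' * d' ^+ 2)| <= 3/2 * (3 * h).
  by apply: hu => //; lra.
move: b1 b2 b3; rewrite !ler_norml; set x1 := _ * (g - g'); set x2 := _ * (g * g ^+ 2 - _); set x3 := _ * (_ - _).
by move=> /andP[? ?] /andP[? ?] /andP[? ?]; apply/andP; split; lra.
Qed.

(** When u^2 + u > 1 the interval from 1/(u^2+2u) to (2u-1)/u^2 is nonempty. If
    gamma^2 exceeds the lower end then delta is contracted; if gamma^2 is at
    most the upper end then gamma grows, and gamma -> gamma (1 + 2u - u^2
    gamma^2) is increasing on [0,1]. So a threshold g1 with g1^2 strictly inside
    the interval gives a region that is mapped into itself with a margin, once
    delta is small enough not to disturb gamma. *)
Lemma saddle_trap : 0 <= u -> u <= 1 -> 1 < u ^+ 2 + u ->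
  exists g1 d1 e : R, [/\ 0 < d1, d1 < 1, d1 <= 1 - g1, 0 < e &
   forall d g, in_domain d g -> `|d| <= d1 -> g1 <= g ->
     `|Fd d g| <= d1 - e /\ g1 + e <= Fg d g].
Proof.
move=> u0 u1 hu.
have u0' : 0 < u by nra.
have v0 : 0 < u ^+ 2 + 2 * u by nra.
have w0 : 0 < u ^+ 2 by nra.
pose a := 1 / (u ^+ 2 + 2 * u). pose b := (2 * u - 1) / u ^+ 2.
have ha : (u ^+ 2 + 2 * u) * a = 1 by rewrite /a mulrC divfK // gt_eqF.
have hb : u ^+ 2 * b = 2 * u - 1 by rewrite /b mulrC divfK // gt_eqF.
have ab : a < b.
  rewrite /a /b ltr_pdivrMr // mulrAC ltr_pdivlMr //; nra.
have a0 : 0 < a by rewrite divr_gt0.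
pose G := (a + b) / 2; pose g1 := Num.sqrt G.
have G0 : 0 < G by rewrite /G; lra.
have gG : g1 ^+ 2 = G by rewrite sqr_sqrtr // ltW.
have g10 : 0 < g1 by rewrite sqrtr_gt0.
have G1 : 1 < (u ^+ 2 + 2 * u) * G by rewrite /G; nra.
have G2 : u ^+ 2 * G < 2 * u - 1 by rewrite /G; nra.
have g11 : g1 < 1.
  have : G < 1 by rewrite -(ltr_pM2l w0); nra.
  rewrite -gG; nra.
pose mu := g1 * (2 * u - 1 - u ^+ 2 * G) / 2.
have mu0 : 0 < mu by rewrite divr_gt0 // mulr_gt0 //; lra.
pose c := (3 - (u ^+ 2 + 2 * u) * G) / 2.
have c1 : c < 1 by rewrite /c; lra.
pose d1 := Num.min (mu / 3) (Num.min (1 - g1) (1/2)).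
have d10 : 0 < d1 by rewrite !lt_min; apply/and3P; split; lra.
have [d1a d1b d1c] : [/\ d1 <= mu / 3, d1 <= 1 - g1 & d1 <= 1/2].
  by rewrite /d1; split; rewrite !ge_min lexx ?orbT.
pose e := Num.min ((1 - c) * d1) (mu / 2).
have e0 : 0 < e by rewrite lt_min mulr_gt0 //=; [lra|lra].
have [e1 e2] : e <= (1 - c) * d1 /\ e <= mu / 2 by rewrite /e; split; rewrite !ge_min lexx ?orbT.
exists g1, d1, e; split => //; first by lra.
move=> d g dom hd hg.
have sq := in_domain_sqr dom; case: dom => h1 h2 h3 h4.
have g1' : g <= 1 by lra.
have gg : G <= g ^+ 2 by rewrite -gG; nra.
split.
  have M0 : 0 <= 3 - d ^+ 2 - (u ^+ 2 + 2 * u) * g ^+ 2.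
    have : (u ^+ 2 + 2 * u) * g ^+ 2 <= 3 * g ^+ 2 by rewrite ler_wpM2r ?sqr_ge0 //; nra.
    have := sqr_ge0 d; lra.
  have M1 : 3 - d ^+ 2 - (u ^+ 2 + 2 * u) * g ^+ 2 <= 2 * c.
    have : (u ^+ 2 + 2 * u) * G <= (u ^+ 2 + 2 * u) * g ^+ 2 by rewrite ler_wpM2l // ltW.
    have := sqr_ge0 d; rewrite /c; lra.
  rewrite /next_delta -mulrA normrM [X in _ * X]ger0_norm ?divr_ge0 //.
  apply: le_trans (_ : d1 * c <= _); last by lra.
  by rewrite ler_pM ?divr_ge0 //; lra.
have d2 : d ^+ 2 <= d1 ^+ 2 by rewrite -real_normK ?num_real // lerXn2r ?nnegrE ?(ltW d10).
have k1 : g1 * (1 + 2 * u - u ^+ 2 * g1 ^+ 2) <= g * (1 + 2 * u - u ^+ 2 * g ^+ 2).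
  have : 0 <= (g - g1) * ((1 + 2 * u) - u ^+ 2 * (g ^+ 2 + g * g1 + g1 ^+ 2)).
    rewrite mulr_ge0 ?subr_ge0 //.
    have : u ^+ 2 * (g ^+ 2 + g * g1 + g1 ^+ 2) <= u ^+ 2 * 3.
      by rewrite ler_wpM2l ?(ltW w0) //; nra.
    nra.
  lra.
have k2 : g * ((1 + 2 * u) * d ^+ 2) <= 3 * d1 ^+ 2.
  have : (1 + 2 * u) * d ^+ 2 <= 3 * d1 ^+ 2 by rewrite ler_pM ?sqr_ge0 //; lra.
  apply: le_trans; rewrite ler_piMl // mulr_ge0 ?sqr_ge0 //; lra.
have k3 : d1 ^+ 2 <= mu / 3.
  by rewrite expr2; apply: le_trans d1a; rewrite ler_piMl ?(ltW d10) //; lra.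
rewrite gG in k1.
rewrite /next_gamma.
have : g1 * (1 + 2 * u - u ^+ 2 * G) = 2 * mu + 2 * g1 by rewrite /mu; field.
lra.
Qed.
End MeanField.

(** * Convergence of the mean-field map below the critical assortativity *)

Section Converge.
Context {R : realType} (u : R).
Implicit Types d g : R.
Local Notation Fd := (next_delta u).
Local Notation Fg := (next_gamma u).
Hypothesis u0 : 0 <= u.
Hypothesis hu : u ^+ 2 + u < 1.

Let u1 : u < 1. Proof. move: u0 hu; nra. Qed.

(** A level for u gamma^2 with two properties, both equivalent to u^2 + u < 1:
    above it gamma is contracted (c1 > 0), and below it the ratio gamma/delta is
    contracted (1 - u - w > 0). *)
Let w : R := (1 - u + u ^+ 2) / 2.
Let c1 : R := (u * w - (2 * u - 1)) / 2.

Let w0 : 0 < w. Proof. by rewrite /w; move: u0 hu; nra. Qed.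

Let uw1 : 0 < 1 - u - w. Proof. by rewrite /w; move: hu; lra. Qed.

Let c10 : 0 < c1.
Proof.
have -> : c1 = (1 - u - u ^+ 2) * (2 - u) / 4 by rewrite /c1 /w; field.
by rewrite divr_gt0 // mulr_gt0 //; move: u0 hu u1; lra.
Qed.

Let c11 : c1 <= 1.
Proof. by rewrite /c1 /w; move: u0 u1; nra. Qed.

Lemma factor_ge0 d g : in_domain d g ->
  1 <= 3 - d ^+ 2 - (u ^+ 2 + 2 * u) * g ^+ 2 <= 3 /\
  0 <= 1 + 2 * u - u ^+ 2 * g ^+ 2 - (1 + 2 * u) * d ^+ 2 <= 1 + 2 * u - u ^+ 2 * g ^+ 2.
Proof.
move=> dom; have sq := in_domain_sqr dom.
have := sqr_ge0 d; have := sqr_ge0 g; move: sq; set D := d ^+ 2; set G := g ^+ 2 => sq G0 D0.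
have u2 : 0 <= u ^+ 2 by exact: sqr_ge0.
have h1 : u ^+ 2 * G <= (1 + 2 * u) * G by rewrite ler_wpM2r //; move: u0 u1; nra.
have h2 : (1 + 2 * u) * (D + G) <= (1 + 2 * u) * 1 by rewrite ler_wpM2l //; move: u0; lra.
have h3 : (u ^+ 2 + 2 * u) * G <= 2 * G by rewrite ler_wpM2r //; move: u0 u1 hu; lra.
have h4 : 0 <= (u ^+ 2 + 2 * u) * G by rewrite mulr_ge0 //; move: u0; lra.
have h5 : 0 <= (1 + 2 * u) * D by rewrite mulr_ge0 //; move: u0; lra.
by split; apply/andP; split; lra.
Qed.

(** Above the level w the factor of gamma is at most 1 - c1, and the interval
    [0,w] is invariant. So u gamma^2 falls below w in a bounded number of
    rounds, whatever delta does meanwhile. *)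
Lemma gamma_enters d g x : in_domain d g -> x <= 1 -> u * g ^+ 2 <= Num.max w x ->
  u * Fg d g ^+ 2 <= Num.max w ((1 - c1) * x).
Proof.
move=> dom x1 hH; have [_ /andP[]] := factor_ge0 dom.
set f := 1 + 2 * u - u ^+ 2 * g ^+ 2 - (1 + 2 * u) * d ^+ 2 => f0 f1.
have gE : Fg d g = g * (f / 2) by rewrite /next_gamma -/f mulrA.
set H := u * g ^+ 2 in hH.
have H0 : 0 <= H by rewrite mulr_ge0 ?sqr_ge0.
have f2 : f / 2 <= 1 - c1 + u * (w - H) / 2 by rewrite /c1 /H; lra.
have f20 : 0 <= f / 2 by rewrite divr_ge0.
have -> : u * Fg d g ^+ 2 = H * (f / 2) ^+ 2 by rewrite gE /H exprMn mulrA.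
have [Hw|wH] := lerP H w.
  rewrite le_max; apply/orP; left.
  set e := w - H; have e0 : 0 <= e by rewrite subr_ge0.
  have f3 : f / 2 <= 1 + u * e / 2 by move: f2 c10; rewrite -/e; lra.
  have ue0 : 0 <= u * e by rewrite mulr_ge0.
  apply: le_trans (_ : H * (1 + u * e / 2) ^+ 2 <= _).
    rewrite ler_wpM2l // lerXn2r ?nnegrE //; lra.
  have HE : H = w - e by rewrite /e; ring.
  have wu : w * u <= 1 / 2 by rewrite /w; move: u0 u1; nra.
  have ew : e <= w by rewrite /e; lra.
  have w1 : w <= 1 by rewrite /w; move: u0 u1; nra.
  have k1 : (w * u) * e <= (1/2) * e by rewrite ler_wpM2r.
  have k2 : (w * u) * (u * e * e) <= (1/2) * (u * e * e) by rewrite ler_wpM2r // mulr_ge0.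
  have k3 : 0 <= u * e * e * (u * e) by rewrite !mulr_ge0.
  have k4 : 0 <= u * e * e by rewrite !mulr_ge0.
  rewrite HE; lra.
have Hx : H <= x by move: hH; rewrite le_max leNgt wH.
rewrite le_max; apply/orP; right.
have f4 : f / 2 <= 1 - c1.
  have : 0 <= u * (H - w) by rewrite mulr_ge0 // subr_ge0 ltW.
  lra.
have : H * (f / 2) ^+ 2 <= H * (1 - c1).
  rewrite ler_wpM2l //.
  have : (f / 2) ^+ 2 <= (f / 2) * 1 by rewrite expr2 ler_wpM2l //; move: c10; lra.
  lra.
move=> /le_trans; apply; rewrite mulrC ler_wpM2l //; move: c11; lra.
Qed.

Let rho : R := 1 - 2 * (1 - u - w) / 3.
Let rho0 : 0 <= rho. Proof. rewrite /rho; move: w0 u0 uw1; lra. Qed.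
Let rho1 : rho < 1. Proof. rewrite /rho; move: uw1; lra. Qed.

(** The difference of the two factors is M - f = 2(1 - u) - 2u gamma^2 + 2u
    delta^2 >= 2(1 - u - w), and M <= 3. *)
Lemma ratio_contracts d g c : in_domain d g -> 0 <= c -> u * g ^+ 2 <= w ->
  g ^+ 2 <= c * d ^+ 2 -> Fg d g ^+ 2 <= rho * c * Fd d g ^+ 2.
Proof.
move=> dom c0 hw hc; have [/andP[]] := factor_ge0 dom.
set M := 3 - d ^+ 2 - _ => M1 M3 /andP[].
set f := 1 + 2 * u - u ^+ 2 * g ^+ 2 - (1 + 2 * u) * d ^+ 2 => f0 _.
have gE : Fg d g = g * (f / 2) by rewrite /next_gamma -/f mulrA.
have dE : Fd d g = d * (M / 2) by rewrite /next_delta -/M mulrA.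
have ud0 : 0 <= u * d ^+ 2 by rewrite mulr_ge0 ?sqr_ge0.
have fM : f <= rho * M.
  have : M - f >= 2 * (1 - u - w) by rewrite /M /f; lra.
  have : 2 * (1 - u - w) * M <= 2 * (1 - u - w) * 3 by rewrite ler_wpM2l //; move: uw1; lra.
  by rewrite /rho; lra.
have f2 : f ^+ 2 <= rho * M ^+ 2.
  apply: le_trans (_ : (rho * M) ^+ 2 <= _).
    by rewrite lerXn2r ?nnegrE ?mulr_ge0 //; lra.
  rewrite exprMn ler_wpM2r ?sqr_ge0 // expr2 ler_piMl // ltW //.
rewrite gE dE !exprMn.
apply: le_trans (_ : (c * d ^+ 2) * ((rho * M ^+ 2) * 2^-1 ^+ 2) <= _).
  by rewrite ler_pM ?sqr_ge0 ?mulr_ge0 ?sqr_ge0 // ler_wpM2r ?sqr_ge0.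
by rewrite le_eqVlt; apply/orP; left; apply/eqP; ring.
Qed.

(** Guarantees that a bounded number of rounds cannot destroy the initial bias.
    *)
Lemma delta_half d g : in_domain d g -> 0 <= d -> d / 2 <= Fd d g.
Proof.
move=> dom d0; have [/andP[M1 _] _] := factor_ge0 dom.
rewrite /next_delta -[d * _ / 2]mulrA ler_wpM2l //; lra.
Qed.

(** Once gamma is negligible against delta, delta follows the one-dimensional
    map delta (3 - delta^2) / 2 up to a small loss, and 7/10 is a level below
    which it grows by a factor and above which it stays. *)
Lemma delta_grows d g : in_domain d g -> 0 <= d -> g ^+ 2 <= 1 / 30 * d ^+ 2 ->
  Num.min (7/10) (12/10 * d) <= Fd d g.
Proof.
move=> dom d0 hg.
have d1 : d <= 1 by case: dom => *; lra.
have h : (u ^+ 2 + 2 * u) * g ^+ 2 <= 2 * (1 / 30 * d ^+ 2).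
  by rewrite ler_pM ?sqr_ge0 //; move: u0 u1 hu; [have := sqr_ge0 u; lra|lra].
have : d * (3 - 11/10 * d ^+ 2) / 2 <= Fd d g.
  rewrite /next_delta ler_wpM2r // ler_wpM2l //; have := sqr_ge0 d; lra.
rewrite ge_min.
have [d7|d7] := lerP d (7/10) => hF.
  apply/orP; right; apply: le_trans hF; nra.
apply/orP; left; apply: le_trans hF.
have : 0 <= (1 - d) * (d - 7/10) by rewrite mulr_ge0 //; lra.
nra.
Qed.

(** Near 1 the map delta (3 - delta^2) / 2 has a double contact with its fixed
    point: 1 - delta is multiplied by (1 - delta)(2 + delta)/2. *)
Lemma delta_final d g : in_domain d g -> 7/10 <= d -> 
  1 - Fd d g <= (1 - d) / 2 + g ^+ 2.
Proof.
move=> dom d7; have d1 : d <= 1 by case: dom => *; lra.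
have g0 := sqr_ge0 g.
have h : (u ^+ 2 + 2 * u) * g ^+ 2 <= 2 * g ^+ 2.
  by rewrite ler_wpM2r //; move: u0 u1 hu; lra.
have h0 : 0 <= (u ^+ 2 + 2 * u) * g ^+ 2.
  by rewrite mulr_ge0 //; have := sqr_ge0 u; move: u0; lra.
have h' : d * ((u ^+ 2 + 2 * u) * g ^+ 2) <= 2 * g ^+ 2.
  by apply: le_trans h; rewrite ler_piMl //; lra.
have k : (1 - d) * ((1 - d) * (2 + d)) <= (1 - d) * 1.
  by rewrite ler_wpM2l //; nra.
rewrite /next_delta; lra.
Qed.

Fixpoint mean_orbit t (x : R * R) : R * R :=
  if t is t'.+1 then let y := mean_orbit t' x in (Fd y.1 y.2, Fg y.1 y.2) else x.

Lemma mean_orbit_domain t x : in_domain x.1 x.2 -> in_domain (mean_orbit t x).1 (mean_orbit t x).2.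
Proof.
by move=> dom; elim: t => //= t IH; apply: in_domain_next => //; rewrite ltW.
Qed.

(** Four stages, each of a number of rounds that depends only on the constants:
    u gamma^2 falls below w; gamma^2/delta^2 then decays geometrically for ever;
    as soon as it is below 1/30, delta grows to 7/10; finally 1 - delta is
    halved in each round up to an error that decays with gamma^2. *)
Lemma mean_field_converges (kap d0 : R) : 0 < kap -> 0 < d0 ->
  exists k, forall x, in_domain x.1 x.2 -> kap <= x.1 -> 1 - d0 <= (mean_orbit k x).1.
Proof.
move=> kap0 d00.
have kap' : 0 <= 1 - c1 by move: c11; lra.
have kap'' : 1 - c1 < 1 by move: c10; lra.
have [k1 hk1] := expr_small 1 kap' kap'' w0; rewrite mulr1 in hk1.
pose C0 : R := 4 ^+ k1 / kap ^+ 2.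
have C00 : 0 < C0 by rewrite divr_gt0 ?exprn_gt0.
(* C0 bounds gamma^2/delta^2 at round k1, from delta >= kap / 2^k1. *)
have h30 : 0 < 1 / 30 :> R by lra.
have [k2 hk2] := expr_small C0 rho0 rho1 h30.
pose T := (k2 + k1)%N.
have k120 : 0 <= 10/12 :> R by lra.
have k121 : 10/12 < 1 :> R by lra.
have kT : 0 < kap / 2 ^+ T by rewrite divr_gt0 ?exprn_gt0.
have [k3 hk3] := expr_small (7/10) k120 k121 kT.
have d04 : 0 < d0 / 4 by lra.
have [k4 hk4] := expr_small C0 rho0 rho1 d04.
have d02 : 0 < d0 / 2 by lra.
have half0 : 0 <= 1/2 :> R by lra.
have half1 : 1/2 < 1 :> R by lra.
have [k5 hk5] := expr_small 1 half0 half1 d02; rewrite mulr1 in hk5.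
exists (k5 + (k4 + (k3 + T)))%N => x dom kapx.
pose d t := (mean_orbit t x).1; pose g t := (mean_orbit t x).2.
have dg t : in_domain (d t) (g t) by exact: mean_orbit_domain.
have dS t : d t.+1 = Fd (d t) (g t) by [].
have gS t : g t.+1 = Fg (d t) (g t) by [].
have dlow t : kap / 2 ^+ t <= d t.
  elim: t => [|t IH]; first by rewrite expr0 divr1.
  rewrite dS; have dt0 : 0 <= d t by apply: le_trans IH; rewrite divr_ge0 ?exprn_ge0 ?ltW.
  apply: le_trans (delta_half (dg t) dt0).
  by rewrite exprSr invfM mulrA ler_wpM2r.
have dpos t : 0 < d t by apply: lt_le_trans (dlow t); rewrite divr_gt0 ?exprn_gt0.
have g1 t : g t ^+ 2 <= 1.
  have := in_domain_sqr (dg t); have := sqr_ge0 (d t); lra.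
have H1 t : u * g t ^+ 2 <= Num.max w ((1 - c1) ^+ t).
  elim: t => [|t IH].
    rewrite expr0 le_max; apply/orP; right.
    by apply: mulr_ile1; rewrite ?sqr_ge0 // ltW.
  rewrite gS [(1 - c1) ^+ _]exprS; apply: gamma_enters => //.
  by apply: exprn_ile1 => //; rewrite ltW.
have H2 t : u * g (t + k1)%N ^+ 2 <= w.
  have := H1 (t + k1)%N; rewrite le_max => /orP[//|] /le_trans; apply.
  apply: le_trans hk1; rewrite exprD ler_piMl ?exprn_ge0 //.
  by apply: exprn_ile1 => //; rewrite ltW.
have H3 t : g (t + k1)%N ^+ 2 <= rho ^+ t * C0 * d (t + k1)%N ^+ 2.
  elim: t => [|t IH].
    rewrite expr0 mul1r add0n; apply: le_trans (g1 _) _.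
    have := dlow k1; rewrite -(@ler_sqr _ (kap / _)) ?nnegrE ?divr_ge0 ?exprn_ge0 ?(ltW kap0) ?(ltW (dpos _)) // => h.
    apply: le_trans (_ : C0 * (kap / 2 ^+ k1) ^+ 2 <= _); last by rewrite ler_wpM2l // ltW.
    rewrite /C0 expr_div_n -exprM mulnC exprM.
    have -> : (2 ^+ 2 : R) = 4 by ring.
    have k0 : kap ^+ 2 != 0 by rewrite gt_eqF // exprn_gt0.
    have f0 : (4 : R) ^+ k1 != 0 by rewrite gt_eqF // exprn_gt0.
    by rewrite mulrA divfK // divff.
  rewrite addSn gS dS [rho ^+ _]exprS -[rho * _ * C0]mulrA; apply: ratio_contracts => //.
  by rewrite mulr_ge0 ?exprn_ge0 // ltW.
have Hlate a b s : rho ^+ b * C0 <= a -> 0 <= a -> g (s + b + k1)%N ^+ 2 <= a * d (s + b + k1)%N ^+ 2.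
  move=> hb a0; apply: le_trans (H3 _) _; rewrite ler_wpM2r ?sqr_ge0 //.
  apply: le_trans hb; rewrite exprD -mulrA ler_piMl //.
    by apply: mulr_ge0; [exact: exprn_ge0|exact: ltW].
  by apply: exprn_ile1 => //; rewrite ltW.
have H4 j : Num.min (7/10) ((12/10) ^+ j * (kap / 2 ^+ T)) <= d (j + T)%N.
  elim: j => [|j IH].
    by rewrite expr0 mul1r ge_min add0n dlow orbT.
  rewrite addSn dS.
  have h30' : 0 <= 1/30 :> R by lra.
  have := Hlate (1/30) k2 j hk2 h30'; rewrite -addnA -/T => hg.
  apply: le_trans (delta_grows (dg _) (ltW (dpos _)) hg).
  rewrite le_min ge_min lexx /=.
  move: IH; rewrite !ge_min => /orP[h|h]; apply/orP; [left; lra|right].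
  by rewrite exprS -mulrA ler_wpM2l.
have H5 j : 7/10 <= d (j + (k3 + T))%N.
  have := H4 (j + k3)%N; rewrite -addnA; apply: le_trans.
  rewrite le_min lexx /= exprD.
  have p3 : 0 < (12/10 : R) ^+ k3 by rewrite exprn_gt0 //; lra.
  have hk3' : 7/10 <= (12/10) ^+ k3 * (kap / 2 ^+ T).
    have e : (10/12 : R) = (12/10)^-1 by rewrite invf_div.
    by move: hk3; rewrite e exprVn mulrC ler_pdivrMr // [X in _ <= X -> _]mulrC.
  rewrite -mulrA; apply: le_trans hk3' _; rewrite ler_peMl //.
    by apply: mulr_ge0; apply: ltW.
  by apply: exprn_ege1; lra.
have H6 j : 1 - d (j + (k4 + (k3 + T)))%N <= d0 / 2 + (1/2) ^+ j.
  elim: j => [|j IH].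
    have := dpos (k4 + (k3 + T))%N; rewrite expr0 add0n; lra.
  have d7 : 7/10 <= d (j + (k4 + (k3 + T)))%N by rewrite addnA; exact: H5.
  rewrite addSn dS; apply: le_trans (delta_final (dg _) d7) _.
  have := Hlate (d0 / 4) k4 (j + k3 + k2)%N hk4 (ltW d04).
  have -> : (j + k3 + k2 + k4 + k1 = j + (k4 + (k3 + T)))%N by rewrite /T; ring.
  set dd := d _ in IH *; set gg := g _ => hgg.
  have dd2 : dd ^+ 2 <= 1.
    have := in_domain_sqr (dg (j + (k4 + (k3 + T)))%N); rewrite -/dd; have := sqr_ge0 (g (j + (k4 + (k3 + T)))%N); lra.
  have : d0 / 4 * dd ^+ 2 <= d0 / 4 * 1 by rewrite ler_wpM2l // ltW.
  rewrite [(1 / 2) ^+ _]exprS; lra.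
have := H6 k5; rewrite -/(d _); lra.
Qed.
End Converge.

(** * Voting follows the mean-field map *)

Section Phases.
Context {R : realType} {n : nat} (p q e r : R).
Local Notation V := (sbm_vertex n).
Implicit Types (A S B : {set V}).
Local Notation N := (n%:R : R).
Local Notation D := (n%:R * p : R).
Hypothesis e_gt0 : 0 < e.
Hypothesis e_le : e <= 1/2.
Hypothesis q_ge0 : 0 <= q.
Hypothesis q_le_p : q <= p.
Hypothesis p_le1 : p <= 1.
Hypothesis D_ge1 : 1 <= D.
Hypothesis r_ge0 : 0 <= r.
Hypothesis r_le1 : r <= 1.
Hypothesis qE : q = r * p.
Hypothesis n_gt0 : (0 < n)%N.
Variable E : {set {set V}}.
Hypothesis gE : good_graph p q e E.
Local Notation u := (assortativity r).
Local Notation dl := (@delta R n).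
Local Notation gm := (@gamma R n).
Local Notation fail := (4 * expR (- (e ^+ 2 * N / 8))).

Let N0 : 0 < N. Proof. by rewrite ltr0n. Qed.

Let r1 : 0 < 1 + r. Proof. by move: r_ge0; lra. Qed.

Lemma assortativity_ge0 : 0 <= u.
Proof. by rewrite /assortativity divr_ge0 ?subr_ge0 // ltW. Qed.

Lemma assortativity_le1 : u <= 1.
Proof. by rewrite /assortativity ler_pdivrMr // mul1r; move: r_ge0; lra. Qed.

Lemma state_in_domain A : in_domain (dl A) (gm A).
Proof.
have h1 := block_frac_ge0 (R := R) A true; have h2 := block_frac_ge0 (R := R) A false.
have h3 := @block_frac_le1 R n p D_ge1 A true; have h4 := @block_frac_le1 R n p D_ge1 A false.
by rewrite /delta /gamma; split; lra.
Qed.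

Lemma in_domain_norm (d g : R) : in_domain d g -> `|d| <= 1 /\ `|g| <= 1.
Proof. by case=> *; rewrite !ler_norml; split; apply/andP; split; lra. Qed.

Lemma card_delta A : #|A|%:R = N * (1 + dl A) :> R.
Proof.
have -> : #|A|%:R = #|A :&: block n true|%:R + #|A :&: block n false|%:R :> R.
  rewrite -(cardsID (block n true) A) natrD; congr (_ + _%:R).
  by apply: eq_card => v; rewrite !inE; case: v.1; rewrite ?andbF ?andbT.
by rewrite /delta /block_frac; field; rewrite gt_eqF.
Qed.

Lemma block_fracC A i : block_frac (~: A) i = 1 - block_frac A i :> R.
Proof.
rewrite /block_frac.
have -> : #|~: A :&: block n i|%:R = N - #|A :&: block n i|%:R :> R.
  have := cardsID A (block n i); rewrite card_block => h.
  rewrite -[X in X%:R - _]h natrD [block n i :&: A]finset.setIC addrAC subrr add0r; congr (_%:R).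
  by apply: eq_card => v; rewrite !inE andbC.
by field; rewrite gt_eqF.
Qed.

Lemma deltaC A : dl (~: A)%SET = - dl A.
Proof. by rewrite /delta !block_fracC; ring. Qed.

Lemma bias_delta A : bias R A = 2 * N * `|dl A|.
Proof.
rewrite /bias !card_delta deltaC.
have -> : N * (1 + dl A) - N * (1 + - dl A) = 2 * N * dl A by ring.
by rewrite normrM ger0_norm // mulr_ge0.
Qed.

Lemma consensusC A : consensus (~: A)%SET = consensus A.
Proof.
rewrite /consensus orbC; congr (_ || _); apply/eqP/eqP => [h|->].
- by rewrite -[A]finset.setCK h finset.setCT.
- by rewrite finset.setC0.
- by rewrite -[A]finset.setCK h finset.setC0.
- by rewrite finset.setCT.
Qed.

Lemma vote_prob_consensusC k A :
  vote_prob (R := R) E k (fun B => ~~ consensus B) (~: A)%SET =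
  vote_prob E k (fun B => ~~ consensus B) A.
Proof.
rewrite vote_probC_set; congr (vote_prob _ _ _ _); apply: funext => B.
by rewrite consensusC.
Qed.

(** Errors of single rounds accumulate geometrically because the mean-field map
    is 8-Lipschitz; k is a constant in the application. *)
Lemma bulk_track k A :
  vote_prob E k (fun B => ~~ near_state (18 * e * 9 ^+ k)
     (mean_orbit u k (dl A, gm A)).1 (mean_orbit u k (dl A, gm A)).2 B) A <= k%:R * fail.
Proof.
elim: k => [|k IH].
  rewrite /vote_prob /= mul0r /near_state !subrr normr0 expr0 mulr1.
  by rewrite mulr_ge0 ?(ltW e_gt0).
have f0 : 0 <= fail by rewrite mulr_ge0 ?expR_ge0.
have -> : k.+1%:R * fail = k%:R * fail + fail :> R by rewrite -natr1 mulrDl mul1r.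
rewrite -[X in vote_prob _ X _ _]addn1.
apply: (vote_prob_comp (Y := near_state (18 * e * 9 ^+ k)
     (mean_orbit u k (dl A, gm A)).1 (mean_orbit u k (dl A, gm A)).2)) => //.
move=> B /andP[hd hg].
apply: le_trans (vote_step_near e_gt0 e_le q_ge0 D_ge1 gE r_ge0 qE B).
apply: vote_prob_sub => B' /=; apply: contra => /andP[hd' hg'].
have dA : in_domain (mean_orbit u k (dl A, gm A)).1 (mean_orbit u k (dl A, gm A)).2.
  by elim: (k) => [|j IHj]; [exact: state_in_domain|apply: in_domain_next => //; [exact: assortativity_ge0|exact: assortativity_le1]].
have [b1 b2] := in_domain_norm (state_in_domain B).
have [a1 a2] := in_domain_norm dA.
have [l1 l2] := mean_field_lipschitz assortativity_ge0 assortativity_le1 b1 b2 a1 a2 hd hg.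
have k9 : 1 <= 9 ^+ k :> R by apply: exprn_ege1; lra.
have e9 : 18 * e <= 18 * e * 9 ^+ k by rewrite ler_peMr // mulr_ge0 ?(ltW e_gt0).
rewrite /near_state exprS.
apply/andP; split.
  apply: le_trans (ler_distD (next_delta u (dl B) (gm B)) _ _) _; lra.
apply: le_trans (ler_distD (next_gamma u (dl B) (gm B)) _ _) _; lra.
Qed.

(** The trap is mapped into itself with a margin of at least the one-round
    error, so each round adds at most the failure probability of
    [vote_step_near]. *)
Lemma trap_escape (g1 d1 eps : R) :
  (forall d g, in_domain d g -> `|d| <= d1 -> g1 <= g ->
     `|next_delta u d g| <= d1 - eps /\ g1 + eps <= next_gamma u d g) ->
  18 * e <= eps -> forall k A, `|dl A| <= d1 -> g1 <= gm A ->
  vote_prob E k (fun B => ~~ ((`|dl B| <= d1) && (g1 <= gm B))) A <= k%:R * fail.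
Proof.
move=> htrap he k A hA gA.
have f0 : 0 <= fail by rewrite mulr_ge0 ?expR_ge0.
elim: k => [|k IH]; first by rewrite /vote_prob /= hA gA mul0r.
have -> : k.+1%:R * fail = k%:R * fail + fail :> R by rewrite -natr1 mulrDl mul1r.
rewrite -[X in vote_prob _ X _ _]addn1; apply: (vote_prob_comp (Y := fun B => (`|dl B| <= d1) && (g1 <= gm B))) => //.
move=> B /andP[hB gB].
apply: le_trans (vote_step_near e_gt0 e_le q_ge0 D_ge1 gE r_ge0 qE B).
apply: vote_prob_sub => B' /=; apply: contra => /andP[hd' hg'].
have [t1 t2] := htrap _ _ (state_in_domain B) hB gB.
apply/andP; split.
  rewrite -[dl B'](subrK (next_delta u (dl B) (gm B))).
  apply: le_trans (ler_normD _ _) _; lra.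
move: hg'; rewrite ler_norml => /andP[h _]; lra.
Qed.

(** The two consensus states have |delta| = 1 and so lie outside the trap. *)
Lemma trap_no_consensus (g1 d1 eps : R) : d1 < 1 ->
  (forall d g, in_domain d g -> `|d| <= d1 -> g1 <= g ->
     `|next_delta u d g| <= d1 - eps /\ g1 + eps <= next_gamma u d g) ->
  18 * e <= eps -> forall k A, `|dl A| <= d1 -> g1 <= gm A ->
  vote_prob E k consensus A <= k%:R * fail.
Proof.
move=> d11 htrap he k A hA gA.
apply: le_trans (trap_escape htrap he k hA gA).
apply: vote_prob_sub => B hB; apply/negP => /andP[hd _].
have : `|dl B| = 1.
  have cT : #|[set: V]%SET|%:R = 2 * N :> R by rewrite cardsT card_sbm_vertex -mul2n natrM.
  have cB := card_delta B.
  have : N * (1 + dl B) = 0 \/ N * (1 + dl B) = N * 2.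
    by case/orP: hB cB => /eqP -> <-; [left; rewrite cards0|right; rewrite cT mulrC].
  case=> h.
    have -> : dl B = -1 by move/eqP: h; rewrite mulf_eq0 gt_eqF //= => /eqP; lra.
    by rewrite normrN1.
  have -> : dl B = 1 by have := mulfI (lt0r_neq0 N0) h; lra.
  by rewrite normr1.
by move=> h; move: hd d11; rewrite h; lra.
Qed.

Lemma sum_adopt_small A : 256 * #|A|%:R <= N ->
  \sum_v adopt E A v <= 20 * (@exposure R n p #|A| * #|A|%:R) :> R.
Proof.
case: (posnP #|A|) => [A0 _|A0]; last exact: (sum_adopt_nonempty e_le q_ge0 q_le_p D_ge1 gE).
rewrite A0 !mulr0 big1 // => v _; rewrite (cards0_eq A0) /adopt inE /vote_frac finset.setI0 cards0.
by rewrite mul0r expr0n.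
Qed.
End Phases.

(** * Extinction of a small minority *)

Lemma sqrt_expR (R : realType) (x : R) : Num.sqrt (expR x) = expR (x / 2).
Proof.
have -> : expR x = expR (x / 2) ^+ 2.
  by rewrite -expRM_natl; congr expR; field.
by rewrite sqrtr_sqr ger0_norm ?expR_ge0.
Qed.

Lemma expR_ge_pow2 (R : realType) k (x : R) : k%:R <= x -> 2 ^+ k <= expR x.
Proof.
move=> kx; apply: le_trans (_ : expR 1 ^+ k <= _).
  by rewrite lerXn2r ?nnegrE ?expR_ge0 //; have := expR_ge1Dx (1 : R); lra.
by rewrite -expRM_natl mulr1 ler_expR.
Qed.

Section SmallSets.
Context {R : realType} {n : nat} (p q e : R).
Local Notation V := (sbm_vertex n).
Implicit Types (A S B : {set V}).
Local Notation N := (n%:R : R).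
Local Notation D := (n%:R * p : R).
Hypothesis e_le : e <= 1/2.
Hypothesis q_ge0 : 0 <= q.
Hypothesis q_le_p : q <= p.
Hypothesis p_le1 : p <= 1.
Hypothesis D_ge1 : 1 <= D.
Variable E : {set {set V}}.
Hypothesis gE : good_graph p q e E.
Hypothesis lnD_ge : 80 <= ln D.
Hypothesis N_ge : 16 * 80 ^+ 2 <= Num.sqrt N.

Local Notation eta := (@root4_inv R n p).
Local Notation rate := (expR (- (ln D / 16))).
Local Notation sp := (@exposure R n p).

Let D0 : 0 < D. Proof. exact: lt_le_trans D_ge1. Qed.
Let sN0 : 0 < Num.sqrt N. Proof. by apply: lt_le_trans N_ge; rewrite mulr_gt0 ?exprn_gt0. Qed.
Let N0 : 0 < N. Proof. by rewrite -sqrtr_gt0. Qed.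
Let sNE : Num.sqrt N ^+ 2 = N. Proof. by rewrite sqr_sqrtr // ltW. Qed.

Lemma root4_invE : eta = expR (- (ln D / 4)).
Proof.
rewrite /root4_inv -[in LHS](lnK D0) !sqrt_expR -expRN; congr expR; by field.
Qed.

(** All rates of decay are dominated by the single rate (np)^(-1/16); the
    constants 80 and 20 are absorbed by ln(np) >= 80. *)
Lemma eta_rate : [/\ 80 * eta <= rate, 20 * Num.sqrt eta <= rate, rate <= 1/2 & 256 * eta <= 1].
Proof.
rewrite root4_invE sqrt_expR; move: lnD_ge; set X := ln D => hX.
have h (a : R) k (b : R) : k%:R <= a -> b <= 2 ^+ k -> b * expR (- a) <= 1.
  move=> ka bk; rewrite expRN ler_pdivrMr ?expR_gt0 // mul1r.
  exact: le_trans bk (expR_ge_pow2 ka).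
have d (a b c : R) : b * expR (- (c - a)) <= 1 -> b * expR (- c) <= expR (- a).
  move=> h1; have -> : - c = - (c - a) - a by ring.
  by rewrite [expR (_ - a)]expRD mulrA ler_piMl ?expR_ge0.
split.
- apply: d; apply: (h _ 7%N); lra.
- have -> : - (X / 4) / 2 = - (X / 8) by field.
  by apply: d; apply: (h _ 5%N); lra.
- have := h (X / 16) 5%N 32; have : (5%:R : R) <= X / 16 by lra.
  move=> h5 /(_ h5) h6; have : (32 : R) <= 2 ^+ 5 by lra.
  by move=> /h6; lra.
- apply: (h _ 8%N); lra.
Qed.

(** Normalised so that one round sends z to at most z max(sqrt z, rate), see
    [shrunk_next]. *)
Definition rel_size A : R := 80 ^+ 2 * #|A|%:R / N.
Local Notation z := rel_size.

Lemma rel_size_ge0 A : 0 <= z A.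
Proof. by rewrite divr_ge0 ?(ltW N0) // mulr_ge0 // exprn_ge0. Qed.

Lemma exposure80 A : 80 * sp #|A| <= Num.max (Num.sqrt (z A)) rate.
Proof.
have [h _ _ _] := eta_rate.
have -> : Num.sqrt (z A) = 80 * Num.sqrt (#|A|%:R / N).
  have p80 : 0 <= 80 ^+ 2 :> R by rewrite exprn_ge0.
  by rewrite /rel_size -mulrA sqrtrM // sqrtr_sqr ger0_norm.
rewrite /exposure maxr_pMr // ge_max !le_max lexx /=.
by apply/orP; right.
Qed.

(** Among t rounds, a were of the superlinear type (z sent below z^(3/2)) and b
    of the geometric type. Keeping two separate bounds, each of which ignores
    the other type, makes the total number of rounds the sum of the two worst
    cases. *)
Definition shrunk t : pred {set V} := fun B =>
  `[< #|B|%:R <= 4 * Num.sqrt N \/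
      exists a b, [/\ (a + b = t)%N, z B <= 1/4, z B <= expR (- ((3/2) ^+ a)) & z B <= rate ^+ b] >].

Lemma rel_size_tiny A : #|A|%:R <= 4 * Num.sqrt N -> z A <= 1/4.
Proof.
move=> h; rewrite /rel_size ler_pdivrMr // -sNE.
have h2 : 16 * 80 ^+ 2 * Num.sqrt N <= Num.sqrt N * Num.sqrt N by rewrite ler_wpM2r // ltW.
have h3 : 80 ^+ 2 * #|A|%:R <= 80 ^+ 2 * (4 * Num.sqrt N) by rewrite ler_wpM2l // exprn_ge0.
rewrite expr2 in h2 h3 *; lra.
Qed.

Lemma rel_size_256 A : z A <= 1/4 -> 256 * #|A|%:R <= N.
Proof.
rewrite /rel_size ler_pdivrMr // => h; have : 0 <= #|A|%:R :> R by [].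
rewrite expr2 in h; lra.
Qed.

Lemma shrunk_le t A : shrunk t A -> z A <= 1/4.
Proof. by move=> /asboolP[/rel_size_tiny//|[a [b []]]]. Qed.

(** The next size is at most four times the mean unless that is below sqrt n,
    and 4 * 20 = 80 is the factor built into z. Whichever of sqrt z and the rate
    attains the maximum decides the type of the round. *)
Lemma shrunk_next t A B : shrunk t A ->
  #|B|%:R < 4 * Num.max (20 * (sp #|A| * #|A|%:R)) (Num.sqrt N) -> shrunk t.+1 B.
Proof.
move=> hA; have z4 := shrunk_le hA; have z0 := rel_size_ge0 A.
have [_ _ rate2 _] := eta_rate.
have h80 := exposure80 A; set m := Num.max _ _ in h80.
have sz : Num.sqrt (z A) <= 1/2.
  have -> : 1/2 = Num.sqrt ((1/2) ^+ 2) :> R by rewrite sqrtr_sqr ger0_norm.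
  by apply: ler_wsqrtr; rewrite expr2; lra.
have m2 : m <= 1/2 by rewrite /m ge_max sz rate2.
move=> hB; apply/asboolP.
case: (lerP (20 * (sp #|A| * #|A|%:R)) (Num.sqrt N)) hB => [_|_] hB; first by left; exact: ltW.
have hBA : #|B|%:R <= m * #|A|%:R.
  apply: le_trans (ltW hB) _.
  have -> : 4 * (20 * (sp #|A| * #|A|%:R)) = 80 * sp #|A| * #|A|%:R by ring.
  by rewrite ler_wpM2r.
have zB : z B <= m * z A.
  rewrite /rel_size mulrA ler_wpM2r ?invr_ge0 ?(ltW N0) // mulrCA ler_wpM2l // exprn_ge0 //.
have sA0 : 0 <= #|A|%:R :> R by [].
move/asboolP: hA => [hA|[a [b [abt _ za zb]]]].
  left; have : m * #|A|%:R <= 1/2 * #|A|%:R by rewrite ler_wpM2r.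
  lra.
right; have zBA : z B <= 1/2 * z A by apply: le_trans zB _; rewrite ler_wpM2r.
have zB1 : z B <= z A by lra.
case: (lerP rate (Num.sqrt (z A))) => hm.
  exists a.+1, b; split; [by rewrite addSn abt|lra| |lra].
  have mE : m = Num.sqrt (z A) by apply/max_idPl.
  rewrite mE in zB; apply: le_trans zB _.
  have -> : - (3/2) ^+ a.+1 = - ((3/2) ^+ a) / 2 + - ((3/2) ^+ a) :> R.
    by rewrite exprS; field.
  rewrite expRD ler_pM ?sqrtr_ge0 //.
  by rewrite -sqrt_expR ler_wsqrtr.
exists a, b.+1; split; [by rewrite addnS abt|lra|lra|].
have mE : m = rate by apply/max_idPr; exact: ltW.
rewrite mE in zB; apply: le_trans zB _; rewrite exprS ler_wpM2l ?expR_ge0 //.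
Qed.

Lemma sum_adopt_rel_size A : z A <= 1/4 -> \sum_v adopt E A v <= 20 * (sp #|A| * #|A|%:R).
Proof.
move=> zA.
exact: (sum_adopt_small e_le q_ge0 q_le_p D_ge1 gE (rel_size_256 zA)).
Qed.

Lemma shrunk_step t A : shrunk t A ->
  vote_prob E 1 (fun B => ~~ shrunk t.+1 B) A <= expR (- Num.sqrt N).
Proof.
move=> hA; have zA := shrunk_le hA.
set M := Num.max (20 * (sp #|A| * #|A|%:R)) (Num.sqrt N).
have hM : \sum_v adopt E A v <= M.
  by apply: le_trans (sum_adopt_rel_size zA) _; rewrite le_max lexx.
apply: le_trans (le_trans (vote_chernoff_large hM) _); last first.
  by rewrite ler_expR lerN2 le_max lexx orbT.
apply: le_vote_step => B; case: (lerP (4 * M) _) => h; first by rewrite lern1 leq_b1.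
by rewrite (shrunk_next hA h).
Qed.

Lemma shrunk_prob t A : shrunk 0 A ->
  vote_prob E t (fun B => ~~ shrunk t B) A <= t%:R * expR (- Num.sqrt N).
Proof.
move=> hA; elim: t => [|t IH]; first by rewrite /vote_prob /= hA mul0r.
rewrite -natr1 mulrDl mul1r -[X in vote_prob _ X _ _]addn1.
apply: (vote_prob_comp (Y := shrunk t)) => //.
exact: shrunk_step.
Qed.

(** After ka + kb rounds, at least ka were of the first type or at least kb of
    the second. *)
Lemma shrunk_end ka kb B : ln N <= (3/2) ^+ ka -> rate ^+ kb <= N^-1 ->
  shrunk (ka + kb) B -> #|B|%:R <= 4 * Num.sqrt N.
Proof.
move=> hka hkb /asboolP[//|[a [b [ab _ za zb]]]].
have [_ _ rate2 _] := eta_rate.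
have zN : z B <= N^-1.
  case: (leqP ka a) => ha.
    apply: le_trans za _; rewrite -[N^-1]lnK ?posrE ?invr_gt0 // ler_expR lnV ?posrE // lerN2.
    apply: le_trans hka _; rewrite ler_eXn2l //; lra.
  have hb : (kb <= b)%N by rewrite -(leq_add2l ka) -ab leq_add2r ltnW.
  apply: le_trans zb _; apply: le_trans hkb.
  by rewrite -(subnK hb) exprD ler_piMl ?exprn_ge0 ?expR_ge0 // exprn_ile1 ?expR_ge0 //; lra.
have : 80 ^+ 2 * #|B|%:R <= 1 :> R.
  by move: zN; rewrite /rel_size ler_pdivrMr // mulVf // gt_eqF.
have : 0 <= #|B|%:R :> R by [].
move: N_ge; rewrite expr2; lra.
Qed.

Local Notation M := (N * eta).

(** Iterated Markov inequality. The expected size contracts by the rate while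
    the size is at most M = n (np)^(-1/4); beyond M the claimed bound exceeds 1,
    so no stopping time is needed. *)
Lemma extinct t A :
  vote_prob E t (fun B => B != finset.set0) A <= Num.max (rate ^+ t) M^-1 * #|A|%:R.
Proof.
have e0 : 0 < eta := eta_gt0 D_ge1.
have M0 : 0 < M by rewrite mulr_gt0.
have [_ h20 rate2 e256] := eta_rate.
elim: t A => [|t IH] A.
  rewrite /vote_prob /= expr0.
  case: (eqVneq A finset.set0) => [->|A0] /=; first by rewrite cards0 mulr0.
  have : 1 * #|A|%:R <= Num.max 1 M^-1 * #|A|%:R by rewrite ler_wpM2r // le_max lexx.
  apply: le_trans; rewrite mul1r ler1n card_gt0 //.
case: (lerP #|A|%:R M) => hA; last first.
  apply: le_trans (vote_prob_le1 _ _ _ _) _.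
  apply: le_trans (_ : M^-1 * #|A|%:R <= _); last by rewrite ler_wpM2r // le_max lexx orbT.
  by rewrite mulrC ler_pdivlMr // mul1r ltW.
have hA256 : 256 * #|A|%:R <= N.
  apply: le_trans (_ : 256 * M <= _); first by rewrite ler_wpM2l.
  by rewrite mulrCA ler_piMr // ltW.
have hs : sp #|A| <= Num.sqrt eta.
  rewrite /exposure ge_max; apply/andP; split.
    by rewrite ler_wsqrtr // ler_pdivrMr // mulrC.
  rewrite -[leLHS](sqr_sqrtr (ltW e0)) expr2 ler_piMl ?sqrtr_ge0 //.
  by rewrite -[X in _ <= X]sqrtr1 ler_wsqrtr //; lra.
rewrite /vote_prob iterS.
apply: le_trans (_ : vote_step E (fun B => 0 + Num.max (rate ^+ t) M^-1 * #|B|%:R) A <= _).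
  by apply: le_vote_step => B; rewrite add0r; exact: IH.
rewrite vote_step_affine add0r vote_step_card.
have hE : \sum_v adopt E A v <= rate * #|A|%:R.
  apply: le_trans (sum_adopt_small e_le q_ge0 q_le_p D_ge1 gE hA256) _.
  rewrite mulrA ler_wpM2r //; apply: le_trans h20; rewrite ler_wpM2l //.
have mx0 : 0 <= Num.max (rate ^+ t) M^-1 by rewrite le_max exprn_ge0 // expR_ge0.
apply: le_trans (ler_wpM2l mx0 hE) _; rewrite mulrA ler_wpM2r //.
rewrite maxr_pMl ?expR_ge0 // ge_max exprSr !le_max lexx /=.
by apply/orP; right; rewrite ler_piMr ?invr_ge0 ?(ltW M0) //; lra.
Qed.

(** The first ka + kb rounds bring the minority down to 4 sqrt n, the last kb
    rounds extinguish it. *)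
Lemma small_set_consensus ka kb A : z A <= 1/4 ->
  ln N <= (3/2) ^+ ka -> rate ^+ kb <= N^-1 ->
  vote_prob E (ka + kb + kb) (fun B => ~~ consensus B) A <=
  (ka + kb)%:R * expR (- Num.sqrt N) + M^-1 * (4 * Num.sqrt N).
Proof.
move=> zA hka hkb.
have [_ _ _ e256] := eta_rate.
have e0 : 0 < eta := eta_gt0 D_ge1.
have M0 : 0 < M by rewrite mulr_gt0.
apply: (vote_prob_comp (Y := shrunk (ka + kb))).
- by rewrite mulr_ge0 ?invr_ge0 ?(ltW M0) // mulr_ge0 ?sqrtr_ge0.
- apply: shrunk_prob; apply/asboolP; right; exists 0%N, 0%N.
  split => //; rewrite !expr0; last by lra.
  apply: le_trans zA _; rewrite expRN -[1/4]invf_div divr1 lef_pV2 ?posrE ?expR_gt0 //.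
  have h := expR_le_quad (lexx (1/2 : R)).
  have -> : 1 = 2%:R * (1/2) :> R by field.
  rewrite expRM_natl; apply: le_trans (_ : 2 ^+ 2 <= _); last by rewrite expr2; lra.
  by rewrite lerXn2r ?nnegrE ?expR_ge0 //; lra.
move=> B hB; have hB4 := shrunk_end hka hkb hB.
apply: le_trans (_ : Num.max (rate ^+ kb) M^-1 * #|B|%:R <= _).
  apply: le_trans (extinct kb B).
  by apply: vote_prob_sub => B'; rewrite negb_or => /andP[].
rewrite ler_pM ?le_max ?exprn_ge0 ?expR_ge0 // ge_max lexx andbT.
apply: le_trans hkb _; rewrite lef_pV2 ?posrE //.
by rewrite ler_piMr ?(ltW N0) //; lra.
Qed.
End SmallSets.

(** * From a biased start to consensus *)

Lemma consensus_stays (R : realType) (V : finType) (E : {set {set V}}) l (B : {set V}) :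
  consensus B -> vote_prob (R := R) E l (fun B => ~~ consensus B) B = 0.
Proof.
rewrite /vote_prob; elim: l B => [|l IH] B hB; first by rewrite /= hB.
rewrite /= /vote_step big1 // => s _; rewrite IH ?mulr0 //.
exact: consensus_next.
Qed.

Lemma vote_prob_consensus_mono (R : realType) (V : finType) (E : {set {set V}}) k l (A : {set V}) :
  (k <= l)%N -> vote_prob (R := R) E l (fun B => ~~ consensus B) A <=
  vote_prob E k (fun B => ~~ consensus B) A.
Proof.
move=> /subnKC <-; rewrite -[leRHS]addr0.
apply: (vote_prob_comp (Y := consensus)) => // B hB.
by rewrite consensus_stays.
Qed.

Section Assembly.
Context {R : realType} {n : nat} (p q e r : R).
Local Notation V := (sbm_vertex n).
Implicit Types (A S B : {set V}).
Local Notation N := (n%:R : R).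
Local Notation D := (n%:R * p : R).
Hypothesis e_gt0 : 0 < e.
Hypothesis e_le : e <= 1/2.
Hypothesis q_ge0 : 0 <= q.
Hypothesis q_le_p : q <= p.
Hypothesis p_le1 : p <= 1.
Hypothesis D_ge1 : 1 <= D.
Hypothesis r_ge0 : 0 <= r.
Hypothesis r_le1 : r <= 1.
Hypothesis qE : q = r * p.
Hypothesis n_gt0 : (0 < n)%N.
Variable E : {set {set V}}.
Hypothesis gE : good_graph p q e E.
Hypothesis lnD_ge : 80 <= ln D.
Hypothesis N_ge : 16 * 80 ^+ 2 <= Num.sqrt N.

Local Notation d0 := ((8 * 80 ^+ 2)^-1 : R).
Local Notation fail := (4 * expR (- (e ^+ 2 * N / 8))).
Local Notation small_fail ka kb := ((ka + kb)%:R * expR (- Num.sqrt N)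
   + (N * @root4_inv R n p)^-1 * (4 * Num.sqrt N)).

Let N0 : 0 < N. Proof. by rewrite ltr0n. Qed.

(** The constant d0 is chosen so that the minority left by the bulk phase, at
    most 2 d0 n vertices, has relative size at most 1/4. *)
Lemma consensus_from_positive_bias (kap : R) k ka kb A :
  (forall x, in_domain x.1 x.2 -> kap <= x.1 -> 1 - d0 <= (mean_orbit (assortativity r) k x).1) ->
  18 * e * 9 ^+ k <= d0 ->
  ln N <= (3/2) ^+ ka -> expR (- (ln D / 16)) ^+ kb <= N^-1 ->
  kap <= delta A ->
  vote_prob E (k + (ka + kb + kb)) (fun B => ~~ consensus B) A <= k%:R * fail + small_fail ka kb.
Proof.
move=> hk hek hka hkb hA.
have eta0 := eta_gt0 D_ge1.
have dA := @state_in_domain R n p D_ge1 A.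
apply: (vote_prob_comp (Y := near_state (18 * e * 9 ^+ k)
     (mean_orbit (assortativity r) k (delta A, gamma A)).1
     (mean_orbit (assortativity r) k (delta A, gamma A)).2)).
- rewrite addr_ge0 // mulr_ge0 ?expR_ge0 ?invr_ge0 ?mulr_ge0 ?sqrtr_ge0 ?(ltW N0) ?(ltW eta0) //.
- exact: (bulk_track e_gt0 e_le q_ge0 D_ge1 r_ge0 r_le1 qE gE).
move=> B /andP[hB _]; rewrite -(@vote_prob_consensusC R n).
apply: (small_set_consensus e_le q_ge0 q_le_p D_ge1 gE lnD_ge N_ge) => //.
have := hk (delta A, gamma A) dA hA; set x := (mean_orbit _ _ _).1 in hB * => hx.
have dB : 1 - 2 * d0 <= delta B by move: hB; rewrite ler_norml => /andP[h1 _]; lra.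
rewrite /rel_size (@card_delta R n) // deltaC //.
rewrite ler_pdivrMr // mulrA mulrAC ler_pM2r //.
have h : 80 ^+ 2 * (1 + - delta B) <= 80 ^+ 2 * (2 * d0) by rewrite ler_wpM2l ?exprn_ge0 //; lra.
apply: le_trans h _.
by rewrite le_eqVlt; apply/orP; left; apply/eqP; field.
Qed.

Lemma consensus_from_bias (kap : R) k ka kb A :
  (forall x, in_domain x.1 x.2 -> kap <= x.1 -> 1 - d0 <= (mean_orbit (assortativity r) k x).1) ->
  18 * e * 9 ^+ k <= d0 ->
  ln N <= (3/2) ^+ ka -> expR (- (ln D / 16)) ^+ kb <= N^-1 ->
  2 * kap * N <= bias R A ->
  vote_prob E (k + (ka + kb + kb)) (fun B => ~~ consensus B) A <= k%:R * fail + small_fail ka kb.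
Proof.
move=> hk hek hka hkb; rewrite bias_delta // mulrAC ler_pM2l ?mulr_gt0 //.
case: (lerP 0 (@delta R n A)) => [dA|dA] hA.
  by rewrite ger0_norm // in hA; exact: (consensus_from_positive_bias hk hek hka hkb).
rewrite -vote_prob_consensusC; apply: (consensus_from_positive_bias hk hek hka hkb).
by rewrite deltaC // -ltr0_norm.
Qed.
End Assembly.

Section Bounds.
Context {R : realType} {n : nat} (p e : R).
Local Notation N := (n%:R : R).
Local Notation D := (n%:R * p : R).
Hypothesis e_gt0 : 0 < e.
Hypothesis p_le1 : p <= 1.
Hypothesis D_ge1 : 1 <= D.
Hypothesis n_gt0 : (0 < n)%N.
Hypothesis lnD_ge : 80 <= ln D.
Hypothesis lnN_ge : 1 <= ln N.

Let N0 : 0 < N. Proof. by rewrite ltr0n. Qed.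
Let D0 : 0 < D. Proof. exact: lt_le_trans D_ge1. Qed.

Lemma expR_le_inv (x : R) : 0 < x -> expR (- x) <= x^-1.
Proof.
move=> x0; rewrite expRN lef_pV2 ?posrE ?expR_gt0 //.
by apply: le_trans (expR_ge1Dx x); lra.
Qed.

Lemma lnD_le : ln D <= ln N.
Proof. by rewrite ler_ln ?posrE // ler_piMr // ltW. Qed.

(** The number of superlinear rounds; 4 is larger than 1/ln(3/2). *)
Definition quad_rounds := (Num.truncn (4 * ln (ln N))).+1.
(** The number of geometric rounds at the rate (np)^(-1/16). *)
Definition geom_rounds := (Num.truncn (16 * (ln N / ln D))).+1.

Let lnlnN0 : 0 <= ln (ln N). Proof. exact: ln_ge0. Qed.
Let ratio1 : 1 <= ln N / ln D.
Proof. by rewrite ler_pdivlMr ?mul1r ?lnD_le //; move: lnD_ge; lra. Qed.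

Lemma quad_roundsP : ln N <= (3/2) ^+ quad_rounds.
Proof.
have l0 : 0 < ln N by move: lnN_ge; lra.
have /andP[_ h] := truncn_itv (mulr_ge0 (ler0n R 4) lnlnN0).
have h14 : (1/4 : R) <= 1/2 by lra.
have hq := expR_le_quad h14.
apply: le_trans (_ : expR (1/4) ^+ quad_rounds <= _).
  rewrite -expRM_natl -[leLHS]lnK // ler_expR -/quad_rounds.
  move: h; rewrite -/quad_rounds /quad_rounds; set m := _.+1%:R; lra.
by rewrite lerXn2r ?nnegrE ?expR_ge0 //; lra.
Qed.

Lemma geom_roundsP : expR (- (ln D / 16)) ^+ geom_rounds <= N^-1.
Proof.
have l0 : 0 < ln D by move: lnD_ge; lra.
have h0 : 0 <= 16 * (ln N / ln D) by rewrite mulr_ge0 //; move: ratio1; lra.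
have /andP[_ h] := truncn_itv h0.
rewrite -expRM_natl -[N^-1]lnK ?posrE ?invr_gt0 // ler_expR lnV ?posrE //.
have : 16 * (ln N / ln D) * (ln D / 16) <= geom_rounds%:R * (ln D / 16).
  by rewrite ler_wpM2r ?divr_ge0 ?(ltW l0) // ltW.
have -> : 16 * (ln N / ln D) * (ln D / 16) = ln N by field; rewrite gt_eqF.
lra.
Qed.

Lemma quad_rounds_le : quad_rounds%:R <= 4 * ln (ln N) + 1 :> R.
Proof.
have /andP[h _] := truncn_itv (mulr_ge0 (ler0n R 4) lnlnN0).
by rewrite /quad_rounds -natr1 lerD2r.
Qed.

Lemma geom_rounds_le : geom_rounds%:R <= 16 * (ln N / ln D) + 1 :> R.
Proof.
have h0 : 0 <= 16 * (ln N / ln D) by rewrite mulr_ge0 //; move: ratio1; lra.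
have /andP[h _] := truncn_itv h0.
by rewrite /geom_rounds -natr1 lerD2r.
Qed.

Lemma total_rounds_le k :
  (k + (quad_rounds + geom_rounds + geom_rounds))%:R <=
  (k%:R + 40) * (ln (ln N) + ln N / ln D) :> R.
Proof.
have h1 := quad_rounds_le; have h2 := geom_rounds_le.
rewrite !natrD; set X := ln (ln N) in h1 *; set Y := ln N / ln D in h2 *.
have X0 : 0 <= X by []. have Y1 : 1 <= Y by [].
have : k%:R * 1 <= k%:R * (X + Y) by rewrite ler_wpM2l //; lra.
move: h1 h2; set a := quad_rounds%:R; set b := geom_rounds%:R; set c := k%:R.
lra.
Qed.

Lemma total_failure_le k :
  k%:R * (4 * expR (- (e ^+ 2 * N / 8))) +
  ((quad_rounds + geom_rounds)%:R * expR (- Num.sqrt N)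
   + (N * @root4_inv R n p)^-1 * (4 * Num.sqrt N))
  <= (32 * k%:R / e ^+ 2 + 22 * 24 + 4) * N `^ (- (1/4)).
Proof.
have e2 : 0 < e ^+ 2 by rewrite exprn_gt0.
have P0 : N `^ (- (1/4)) = expR (- (ln N / 4)).
  by rewrite /powR gt_eqF //; congr expR; field.
have iN : N^-1 <= N `^ (- (1/4)).
  rewrite P0 -[N^-1]lnK ?posrE ?invr_gt0 // ler_expR lnV ?posrE //.
  by move: lnN_ge; lra.
have N1 : 1 <= N by rewrite ler1n.
rewrite [X in _ <= X]mulrDl [X in _ <= X + _]mulrDl addrA; apply: lerD; first apply: lerD.
- have x0 : 0 < e ^+ 2 * N / 8 by rewrite divr_gt0 // mulr_gt0.
  apply: le_trans (_ : 32 * k%:R / e ^+ 2 * N^-1 <= _); last first.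
    by rewrite ler_wpM2l // divr_ge0 ?(ltW e2) // mulr_ge0.
  have -> : 32 * k%:R / e ^+ 2 * N^-1 = k%:R * (4 * (e ^+ 2 * N / 8)^-1).
    by field; rewrite !gt_eqF.
  by rewrite ler_wpM2l // ler_wpM2l // expR_le_inv.
- apply: le_trans (_ : 22 * 24 * N^-1 <= _); last by rewrite ler_wpM2l.
  have hab : (quad_rounds + geom_rounds)%:R <= 22 * N :> R.
    rewrite natrD; apply: le_trans (lerD quad_rounds_le geom_rounds_le) _.
    have l1 := ln_sublinear N0.
    have l0 : 0 < ln N by move: lnN_ge; lra.
    have l2 := ln_sublinear l0.
    have l3 : ln N / ln D <= ln N.
      rewrite ler_pdivrMr; last by move: lnD_ge; lra.
      by rewrite ler_peMr ?(ltW l0) //; move: lnD_ge; lra.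
    lra.
  have hs : expR (- Num.sqrt N) <= 24 * (N^-1 * N^-1).
    have h := @expR_ge1Dxn R (Num.sqrt N) 3 (sqrtr_ge0 _).
    rewrite expRN -[24]invrK -!invfM lef_pV2 ?posrE ?expR_gt0 ?mulr_gt0 ?invr_gt0 //.
    apply: le_trans h; rewrite [_ ^+ 4](exprM _ 2 2) sqr_sqrtr ?(ltW N0) //.
    have -> : (4`!)%:R = 24 :> R by [].
    by rewrite expr2 [_^-1 * _]mulrC; lra.
  apply: le_trans (ler_pM (ler0n _ _) (expR_ge0 _) hab hs) _.
  by rewrite le_eqVlt; apply/orP; left; apply/eqP; field; rewrite gt_eqF.
- have -> : Num.sqrt N = expR (ln N / 2) by rewrite -sqrt_expR lnK.
  rewrite root4_invE // P0 -[X in (X * _)^-1](lnK N0) -expRD -expRN mulrCA ler_wpM2l //.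
  by rewrite -expRD ler_expR; have := lnD_le; lra.
Qed.
End Bounds.

(** * The voting process as a sequence of random variables *)

Local Open Scope classical_set_scope.

(** The law of total probability for a variable f with finitely many values. *)
Lemma measure_fin_partition (R : realType) (d : measure_display) (Omega : measurableType d)
    (P : {measure set Omega -> \bar R}) (I : finType) (f : Omega -> I) (A : set Omega) :
  (forall i, measurable (A `&` [set w | f w = i])) ->
  P A = (\sum_i P (A `&` [set w | f w = i]))%E.
Proof.
move=> mA.
have eA : A = \bigcup_(i in [set: I]) (A `&` [set w | f w = i]).
  by apply/seteqP; split => [w Aw|w [i _ []]//]; exists (f w).
rewrite [in LHS]eA measure_fin_bigcup //; [|exact: finite_finset|]; last first.
  by move=> i j _ _ [w [[_ <-] [_ <-]]].
rewrite (fsbigE (index_enum I)) ?index_enum_uniq //=; last by move=> i; rewrite mem_index_enum.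
by apply: eq_bigl => i; rewrite in_setT.
Qed.

Section Process.
Context {R : realType} {V : finType} (E : {set {set V}}).
Context (d : measure_display) (Omega : measurableType d) (P : probability Omega R).
Variable W : nat -> Omega -> {ffun V -> V * V}.
Hypothesis HW : voting_rounds E P W.
Implicit Types (A B : {set V}) (X : pred {set V}).

Lemma measurable_opinions A k X : measurable [set w | X (opinions W A k w)].
Proof.
elim: k X => [|k IH] X /=.
  case XA: (X A); first by rewrite (_ : [set _ | _] = setT) //; apply/seteqP; split.
  by rewrite (_ : [set _ | _] = set0) //; apply/seteqP; split.
rewrite (_ : [set _ | _] = \bigcup_(s in [set: {ffun V -> V * V}])
   ([set w | W k w = s] `&` [set w | X (best_of_two s (opinions W A k w))])).
  apply: fin_bigcup_measurable; first exact: finite_finset.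
  move=> s _; apply: measurableI; first exact: HW.1.
  exact: (IH (fun B => X (best_of_two s B))).
apply/seteqP; split => [w /= Xw|w /= [s _ [/= <-]]//].
by exists (W k w).
Qed.

Definition history (h : nat -> {ffun V -> V * V}) j : set Omega :=
  [set w | forall t, (t < j)%N -> W t w = h t].

Definition extend_history (h : nat -> {ffun V -> V * V}) j s :=
  fun t => if t == j then s else h t.

Lemma historyS h j s :
  history h j `&` [set w | W j w = s] = history (extend_history h j s) j.+1.
Proof.
apply/seteqP; split => w /=.
  move=> [H1 H2] t; rewrite ltnS /extend_history; case: eqVneq => [->//|tj tj'].
  by apply: H1; rewrite ltn_neqAle tj.
move=> H; split.
  by move=> t tj; have := H t (ltnW tj); rewrite /extend_history ltn_eqF.
by have := H j (leqnn _); rewrite /extend_history eqxx.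
Qed.

Lemma opinions_history h j A w : history h j w ->
  opinions W A j w = opinions (fun t _ => h t) A j tt.
Proof.
elim: j => //= j IH H.
rewrite IH; last by move=> t tj; apply: H; exact: ltnW.
by rewrite (H j).
Qed.

Lemma opinions_extend_history h j s A :
  opinions (fun t _ => extend_history h j s t) A j tt = opinions (fun t _ => h t) A j tt.
Proof.
have : (j <= j)%N by [].
move: {1 4 5}j => i; elim: i => //= i IH ij.
by rewrite IH ?(ltnW ij) // /extend_history ltn_eqF.
Qed.

Lemma measurable_history h j : measurable (history h j).
Proof.
elim: j h => [|j IH] h.
  by rewrite (_ : history h 0 = setT) //; apply/seteqP; split.
rewrite (_ : history h j.+1 = history h j `&` [set w | W j w = h j]).
  by apply: measurableI => //; exact: HW.1.
rewrite historyS; apply/seteqP; split => w H t tj; rewrite (H t tj) /extend_history; by case: eqP => // ->.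
Qed.

(** The induction on the number k of remaining rounds needs an arbitrary history
    of j rounds, since the hypothesis on W only gives the joint law of initial
    segments. *)
Lemma prob_history_opinions k j h A X :
  P (history h j `&` [set w | X (opinions W A (k + j) w)]) =
  (\prod_(t < j) round_pmf R E (h t) *
   vote_prob E k X (opinions (fun t _ => h t) A j tt))%:E.
Proof.
elim: k j h => [|k IH] j h.
  rewrite add0n /vote_prob /=.
  case XB: (X _).
    rewrite mulr1 -HW.2; congr (P _); apply/seteqP; split => [w []//|w hw].
    by split => //=; rewrite (opinions_history _ hw).
  rewrite mulr0 (_ : _ `&` _ = set0) ?measure0 //.
  by apply/seteqP; split => // w [/(opinions_history A)] /= ->; rewrite XB.
rewrite (@measure_fin_partition _ _ _ P _ (W j)); last first.
  move=> s; apply: measurableI; last exact: HW.1.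
  by apply: measurableI; [exact: measurable_history|exact: measurable_opinions].
rewrite /vote_prob iterS {1}/vote_step mulr_sumr -sumEFin; apply: eq_bigr => s _.
rewrite setIAC historyS addSnnS; apply: (eq_trans (IH _ _)); rewrite big_ord_recr /= opinions_extend_history.
rewrite {2 3}/extend_history eqxx; congr (_%:E); rewrite -mulrA; congr (_ * _).
by apply: eq_bigr => t _; rewrite /extend_history ltn_eqF.
Qed.

Lemma prob_opinions k A X :
  P [set w | X (opinions W A k w)] = (vote_prob E k X A)%:E.
Proof.
pose h := fun _ : nat => [ffun v : V => (v, v)].
have := prob_history_opinions k 0 h A X.
rewrite addn0 big_ord0 mul1r => <-; congr (P _).
by apply/seteqP; split => [w|w []//].
Qed.

Lemma consensus_absorbing k l A w : (k <= l)%N ->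
  consensus (opinions W A k w) -> consensus (opinions W A l w).
Proof.
move=> /subnKC <-; elim: (l - k)%N => [|m IH]; first by rewrite addn0.
by rewrite addnS => /IH; exact: consensus_next.
Qed.

Lemma Tcons_le A w (x : R) k : k%:R <= x -> x < k.+1%:R ->
  (Tcons R W A w <= x%:E)%E = consensus (opinions W A k w).
Proof.
move=> kx xk; apply/idP/idP; last first.
  move=> H; apply: le_trans (_ : (k%:R%:E <= _)%E); last by rewrite lee_fin.
  apply: ereal_inf_lbound; exists k => //=.
  by case/orP: H => /eqP; [left|right].
rewrite leNgt; apply: contraNT => NC.
apply: lt_le_trans (_ : (k.+1%:R%:E <= _)%E); first by rewrite lte_fin.
apply: le_ereal_inf_tmp => _ [t /= H <-].
rewrite lee_fin ler_nat ltnNge; apply: contra NC => tk.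
apply: (consensus_absorbing tk).
by apply/orP; case: H => ->; [left|right].
Qed.

Lemma prob_Tcons_le A (x : R) k : k%:R <= x -> x < k.+1%:R ->
  P [set w | (Tcons R W A w <= x%:E)%E] = (vote_prob E k consensus A)%:E.
Proof.
move=> kx xk; rewrite -prob_opinions; congr (P _).
by apply/seteqP; split=> w /=; rewrite (Tcons_le A w kx xk).
Qed.

(** Here m is the largest integer below x: the consensus time is an integer or
    infinite, and it is at least x exactly when there is no consensus at time m.
    *)
Lemma prob_Tcons_ge A (x : R) : 0 < x -> exists m, m%:R < x /\
  P [set w | (x%:E <= Tcons R W A w)%E] =
  (1 - vote_prob E m consensus A)%:E.
Proof.
move=> x0; have /andP[kx xk] := truncn_itv (ltW x0).
set k := Num.truncn x in kx xk.
(* The floor of x, lowered by 1 when x is an integer. *)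
have [m /andP[mx xm]] : exists m, m%:R < x <= m.+1%:R.
  case: (ltrP k%:R x) => [kx'|xk']; first by exists k; rewrite kx' ltW.
  have xE : x = k%:R by apply/eqP; rewrite eq_le kx xk'.
  have k0 : (0 < k)%N by rewrite -(ltr0n R) -xE.
  by exists k.-1; rewrite prednK // xE lexx ltr_nat ltn_predL k0.
exists m; split=> //.
rewrite vote_probC opprB addrC subrK -prob_opinions; congr (P _).
apply/seteqP; split=> w /=.
  move=> h; rewrite -(@Tcons_le A w m%:R m) // ?ltr_nat // -ltNge.
  by apply: lt_le_trans h; rewrite lte_fin.
move=> NC; apply: le_ereal_inf_tmp => _ [t /= Ht <-]; rewrite lee_fin (le_trans xm) //.
rewrite ler_nat ltnNge; apply: contra NC => tm.
apply: (consensus_absorbing tm).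
by apply/orP; case: Ht => ->; [left|right].
Qed.

End Process.

(** * The two regimes *)

Section Threshold.
Context {R : realType} (r : R).
Hypothesis r_ge0 : 0 <= r.

Let r1 : 0 < (1 + r) ^+ 2. Proof. by rewrite exprn_gt0 //; move: r_ge0; lra. Qed.

(** The threshold of the mean-field map in terms of r: the right side compares
    with 1 as 5 does with (r + 2)^2. *)
Lemma assortativity_sum :
  assortativity r ^+ 2 + assortativity r = 2 * (1 - r) / (1 + r) ^+ 2.
Proof.
have h : 1 + r != 0 by apply: lt0r_neq0; move: r_ge0; lra.
by rewrite /assortativity; field.
Qed.

Lemma above_threshold : Num.sqrt 5 - 2 < r -> assortativity r ^+ 2 + assortativity r < 1.
Proof.
move=> hr; rewrite assortativity_sum ltr_pdivrMr // mul1r.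
have s5 : Num.sqrt 5 ^+ 2 = 5 :> R by rewrite sqr_sqrtr.
have s0 : 0 <= Num.sqrt 5 :> R by exact: sqrtr_ge0.
have : Num.sqrt 5 ^+ 2 < (r + 2) ^+ 2 by rewrite ltrXn2r ?nnegrE //; move: r_ge0; lra.
rewrite s5; lra.
Qed.

Lemma below_threshold : r < Num.sqrt 5 - 2 -> 1 < assortativity r ^+ 2 + assortativity r.
Proof.
move=> hr; rewrite assortativity_sum ltr_pdivlMr // mul1r.
have s5 : Num.sqrt 5 ^+ 2 = 5 :> R by rewrite sqr_sqrtr.
have s0 : 0 <= Num.sqrt 5 :> R by exact: sqrtr_ge0.
have : (r + 2) ^+ 2 < Num.sqrt 5 ^+ 2 by rewrite ltrXn2r ?nnegrE //; move: r_ge0; lra.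
rewrite s5; lra.
Qed.
End Threshold.

Section Asymptotics.
Context {R : realType} (p : nat -> R).
Hypothesis p_omega : p n / (ln n%:R / n%:R) @[n --> \oo] --> +oo.

Lemma natr_large (K : R) : \forall n \near \oo, K <= n%:R.
Proof.
exists (Num.truncn `|K|).+1 => // m /= hm.
apply: le_trans (ler_norm K) _.
have /andP[_ h] := truncn_itv (normr_ge0 K).
by apply: le_trans (ltW h) _; rewrite ler_nat.
Qed.

(** With p = omega(log n / n), every lower bound needed on n, log n and np holds
    for large n. *)
Lemma eventually_large (K : R) : \forall n \near \oo,
  [/\ K <= n%:R, K <= ln n%:R & K * ln n%:R <= n%:R * p n].
Proof.
have h1 := natr_large K.
have h2 := natr_large (expR (Num.max K 1)).
have /cvgryPge/(_ K) h3 := p_omega.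
near=> n; have hN : expR (Num.max K 1) <= n%:R by near: n.
have N0 : 0 < n%:R :> R by apply: lt_le_trans hN; exact: expR_gt0.
have hl : Num.max K 1 <= ln n%:R by rewrite -ler_expR lnK.
have l0 : 0 < ln n%:R :> R by apply: lt_le_trans hl; rewrite lt_max ltr01 orbT.
split; first by near: n.
  by apply: le_trans hl; rewrite le_max lexx.
have : K <= p n / (ln n%:R / n%:R) by near: n.
rewrite ler_pdivlMr ?divr_gt0 // => h.
have : K * (ln n%:R / n%:R) * n%:R <= p n * n%:R by rewrite ler_wpM2r // ltW.
by rewrite [p n * _]mulrC -mulrA divfK // gt_eqF.
Unshelve. all: by end_near.
Qed.
End Asymptotics.

Lemma large_params (R : realType) (N D K : R) :
  expR 80 + 200 ^+ 2 + (16 * 80 ^+ 2) ^+ 2 <= K ->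
  K <= N -> K <= ln N -> K * ln N <= D ->
  [/\ [/\ 1 <= D, 80 <= ln D & 200 <= Num.sqrt D],
      16 * 80 ^+ 2 <= Num.sqrt N, 14 <= N, 1 <= ln N & K <= D].
Proof.
have e0 : 0 < expR 80 :> R by exact: expR_gt0.
have e1 : 0 <= (16 * 80 ^+ 2) ^+ 2 :> R by rewrite exprn_ge0 // mulr_ge0 // exprn_ge0.
have e2 : 14 <= 200 ^+ 2 :> R by rewrite expr2; lra.
set a := 200 ^+ 2 in e2 *; set b := (16 * 80 ^+ 2) ^+ 2 in e1 * => hK KN KlN KD.
have l1 : 1 <= ln N by lra.
have KD' : K <= D.
  by apply: le_trans KD; rewrite ler_peMr //; lra.
split => //; [split| |]; try lra.
- have D0 : 0 < D by lra.
  by rewrite -ler_expR lnK //; lra.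
- have -> : 200 = Num.sqrt a :> R by rewrite /a sqrtr_sqr ger0_norm.
  by apply: ler_wsqrtr; lra.
have -> : 16 * 80 ^+ 2 = Num.sqrt b :> R by rewrite /b sqrtr_sqr ger0_norm // mulr_ge0 // exprn_ge0.
by apply: ler_wsqrtr; lra.
Qed.

(** One block holds opinion 1 entirely and the other does so on a fraction d1,
    rounded down to whole vertices. Then delta is that fraction and gamma is 1
    minus it. *)
Lemma biased_start (R : realType) (n : nat) (d1 : R) : (0 < n)%N ->
  0 < d1 -> d1 < 1 -> 2 <= d1 * n%:R ->
  exists A : {set sbm_vertex n}, [/\ `|delta A| <= d1, 1 - d1 <= gamma A & d1 * n%:R <= bias R A].
Proof.
move=> n0 d10 d11 dn; have N0 : 0 < n%:R :> R by rewrite ltr0n.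
have dn0 : 0 <= d1 * n%:R by rewrite mulr_ge0 // ltW.
have /andP[mle mgt] := truncn_itv dn0; set m := Num.truncn _ in mle mgt.
have mn : (m <= n)%N.
  by rewrite -(ler_nat R); apply: le_trans mle _; rewrite ler_piMl ?ltW.
pose A : {set sbm_vertex n} := [set v : sbm_vertex n | v.1 || (v.2 < m)%N]%SET.
have At : block_frac A true = 1 :> R.
  rewrite /block_frac (_ : A :&: block n true = block n true)%SET.
    by rewrite card_block divff // gt_eqF.
  by apply/setP => v; rewrite !inE; case: v.1 => //=; rewrite andbF.
have Af : block_frac A false = m%:R / n%:R :> R.
  rewrite /block_frac; congr (_%:R / _).
  transitivity #|[set widen_ord mn i | i : 'I_m]%SET|.
    rewrite -(card_imset _ (fun a b : 'I_n => fun h : (false, a) = (false, b) => congr1 snd h)).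
    apply: eq_card => -[i j]; rewrite !inE /=; apply/andP/imsetP.
      case=> h /eqP i0; move: h; rewrite i0 /= => jm.
      exists j => //; apply/imsetP; exists (Ordinal jm) => //; exact: val_inj.
    by case=> x /imsetP[y _ ->] [-> ->]; split => //=.
  rewrite card_imset ?card_ord // => a b h; apply: val_inj; exact: (congr1 val h).
have dE : delta A = m%:R / n%:R :> R by rewrite /delta At Af; ring.
have mN : m%:R / n%:R <= d1 by rewrite ler_pdivrMr.
exists A; split.
- by rewrite dE ger0_norm // divr_ge0.
- by rewrite /gamma At Af; lra.
rewrite bias_delta // dE ger0_norm ?divr_ge0 // -mulrA [n%:R * _]mulrC divfK ?gt_eqF //.
by move: mgt; rewrite -natr1; lra.
Qed.

Theorem theorem1p3 (R : realType) (p q : nat -> R) (r : R)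
    (q_ge0 : forall n, 0 <= q n) (q_le_p : forall n, q n <= p n)
    (p_le1 : forall n, p n <= 1)
    (p_omega : p n / (ln n%:R / n%:R) @[n --> \oo] --> +oo)
    (q_ratio : forall n, q n = r * p n) :
  (Num.sqrt 5 - 2 < r ->
   forall kappa : R, 0 < kappa ->
   exists C C' K : R, [/\ 0 < C, 0 < C', 0 < K &
     whp p q (fun n E =>
       forall A : {set sbm_vertex n}, kappa * n%:R <= bias R A ->
       forall (d : measure_display) (Omega : measurableType d)
         (P : probability Omega R)
         (W : nat -> Omega -> {ffun sbm_vertex n -> sbm_vertex n * sbm_vertex n}),
       voting_rounds E P W ->
       ((1 - K * n%:R `^ (- C'))%:E <=
        P [set w | (Tcons R W A w <=
              (C * (ln (ln n%:R) + ln n%:R / ln (n%:R * p n)))%:E)%E])%E)])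
  /\
  (r < Num.sqrt 5 - 2 ->
   exists kappa C C' K : R, [/\ 0 < kappa, 0 < C, 0 < C', 0 < K &
     whp p q (fun n E =>
       exists A : {set sbm_vertex n}, kappa * n%:R <= bias R A /\
       forall (d : measure_display) (Omega : measurableType d)
         (P : probability Omega R)
         (W : nat -> Omega -> {ffun sbm_vertex n -> sbm_vertex n * sbm_vertex n}),
       voting_rounds E P W ->
       ((1 - K * n%:R `^ (- C'))%:E <=
        P [set w | ((expR (C * n%:R))%:E <= Tcons R W A w)%E])%E)]).
Proof.
(* p n > 0 for large n, and then 0 <= q n <= p n bounds the ratio. *)
have [r_ge0 r_le1] : 0 <= r /\ r <= 1.
  have [m _ /(_ m (leqnn m))[/= m1 l1 h]] := eventually_large p_omega 1.
  have pm : 0 < p m.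
    by rewrite -(@pmulr_rgt0 _ m%:R); [apply: lt_le_trans h; lra|lra].
  have := q_ge0 m; have := q_le_p m; rewrite q_ratio.
  by rewrite ger_pMl // pmulr_lge0.
pose K0 (e : R) := expR 80 + 200 ^+ 2 + (16 * 80 ^+ 2) ^+ 2 + 384 / e ^+ 2 + 2 / e.
have good (e : R) : 0 < e -> e <= 1/2 -> \forall n \near \oo,
   [/\ (0 < n)%N, 2 <= e * n%:R, [/\ 1 <= n%:R * p n, 80 <= ln (n%:R * p n) &
       16 * 80 ^+ 2 <= Num.sqrt n%:R :> R], 1 <= ln n%:R :> R &
       1 - n%:R `^ (- 1) <= sbm_pr (p n) (q n) (@good_graph R n (p n) (q n) e)].
  move=> e0 e2.
  have [e20 e10] : 0 <= 384 / e ^+ 2 /\ 0 <= 2 / e.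
    by split; apply: divr_ge0; [exact: ler0n|exact/exprn_ge0/ltW|exact: ler0n|exact: ltW].
  near=> n.
  have [h1 h2 h3] : [/\ K0 e <= n%:R, K0 e <= ln n%:R & K0 e * ln n%:R <= n%:R * p n].
    by near: n; exact: eventually_large.
  have hK : expR 80 + 200 ^+ 2 + (16 * 80 ^+ 2) ^+ 2 <= K0 e by rewrite /K0; lra.
  have [[D1 lD D200] N16 N14 lN1 KD] := large_params hK h1 h2 h3.
  have N0 : 0 < n%:R :> R by lra.
  have n0 : (0 < n)%N by rewrite -(ltr0n R).
  have b0 : 0 < expR 80 + 200 ^+ 2 + (16 * 80 ^+ 2) ^+ 2 :> R.
    by rewrite addr_gt0 ?exprn_gt0 ?mulr_gt0 ?exprn_gt0 // addr_gt0 ?expR_gt0 ?exprn_gt0.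
  have Ke : 384 / e ^+ 2 <= K0 e by move: b0; rewrite /K0; lra.
  have eN : 2 <= e * n%:R.
    rewrite mulrC -ler_pdivrMr //; apply: le_trans h1.
    by move: b0; rewrite /K0; lra.
  split => //.
  rewrite powR_inv1 ?(ltW N0) //; apply: whp_good_graph => //; first lra.
    rewrite -ler_pdivrMl ?exprn_gt0 // mulrA; apply: le_trans h3.
    by rewrite ler_wpM2r //; [lra|rewrite mulrC].
  by rewrite -ler_pdivrMl ?exprn_gt0 // mulrC; apply: le_trans KD.
split.
- move=> hr kappa kappa0.
  have u0 := assortativity_ge0 r_ge0 r_le1.
  have hu := above_threshold r_ge0 hr.
  have kap0 : 0 < kappa / 2 by rewrite divr_gt0.
  have dd0 : 0 < (8 * 80 ^+ 2)^-1 :> R by rewrite invr_gt0 mulr_gt0 // exprn_gt0.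
  have [k hk] := mean_field_converges u0 hu kap0 dd0.
  (* The error accumulated over k rounds, 18 e 9^k, has to stay below d0. *)
  pose e : R := Num.min (1/2) ((8 * 80 ^+ 2)^-1 / (18 * 9 ^+ k)).
  have k9 : 0 < 18 * 9 ^+ k :> R by rewrite mulr_gt0 ?exprn_gt0.
  have e0 : 0 < e by rewrite lt_min divr_gt0 //= divr_gt0.
  have e2 : e <= 1/2 by rewrite ge_min lexx.
  have ek : 18 * e * 9 ^+ k <= (8 * 80 ^+ 2)^-1.
    rewrite [18 * e]mulrC -mulrA -ler_pdivlMr //.
    by rewrite /e ge_min lexx orbT.
  exists (k%:R + 40), (1/4), (32 * k%:R / e ^+ 2 + 22 * 24 + 4).
  have c0 : 0 < 32 * k%:R / e ^+ 2 + 22 * 24 + 4 :> R.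
    by rewrite ltr_wpDl // addr_ge0 // divr_ge0 ?mulr_ge0 ?exprn_ge0 ?(ltW e0).
  have c1 : 0 < k%:R + 40 :> R by rewrite ltr_wpDl.
  have c2 : 0 < 1/4 :> R by rewrite divr_gt0.
  split => //.
  exists 1; split => //; near=> n.
  have [n0 eN [D1 lD N16] lN1 hgood] : [/\ (0 < n)%N, 2 <= e * n%:R, [/\ 1 <= n%:R * p n, 80 <= ln (n%:R * p n) &
       16 * 80 ^+ 2 <= Num.sqrt n%:R :> R], 1 <= ln n%:R :> R &
       1 - n%:R `^ (- 1) <= sbm_pr (p n) (q n) (@good_graph R n (p n) (q n) e)].
    by near: n; exact: good.
  apply: le_trans hgood _; apply: le_sbm_pr => // E _ gE A hA d Omega P W HW.
  set x := (k%:R + 40) * (_ + _).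
  have hT := total_rounds_le (p_le1 n) D1 n0 lD lN1 k.
  have hF := total_failure_le e0 (p_le1 n) D1 n0 lD lN1 k.
  set T := (k + _)%N in hT.
  have x0 : 0 <= x by apply: le_trans hT.
  have /andP[mx xm] := truncn_itv x0; set m := Num.truncn x in mx xm.
  rewrite (prob_Tcons_le HW A mx xm) lee_fin vote_probC lerB //; apply: le_trans hF.
  have Tm : (T <= m)%N.
    by rewrite -ltnS -(ltr_nat R); apply: le_lt_trans hT xm.
  apply: le_trans (@vote_prob_consensus_mono R _ E _ _ A Tm) _.
  apply: (consensus_from_bias e0 e2 _ _ D1 r_ge0 r_le1 _ n0 gE lD N16 hk ek) => //.
  - exact: quad_roundsP lN1.
  - exact: geom_roundsP.
  - by rewrite mulrCA mulfV // mulr1.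
move=> hr.
have u0 := assortativity_ge0 r_ge0 r_le1.
have u1 := assortativity_le1 r_ge0.
have [g1 [d1 [eps [d10 d11 dg eps0 trap]]]] := saddle_trap u0 u1 (below_threshold r_ge0 hr).
pose e : R := Num.min (1/2) (eps / 18).
have e0 : 0 < e by rewrite lt_min divr_gt0 //= divr_gt0.
have e2 : e <= 1/2 by rewrite ge_min lexx.
have e18 : 18 * e <= eps by rewrite mulrC -ler_pdivlMr // /e ge_min lexx orbT.
have ee0 : 0 < e ^+ 2 by rewrite exprn_gt0.
(* Half of the exponent e^2 n / 8 of a one-round failure pays for the number of
   rounds, the other half remains. *)
exists d1, (e ^+ 2 / 16), 1, (64 / e ^+ 2); split => //; rewrite ?divr_gt0 //.
exists 1; split => //; near=> n.
have [n0 eN [D1 lD N16] lN1 hgood] : [/\ (0 < n)%N, 2 <= e * n%:R, [/\ 1 <= n%:R * p n, 80 <= ln (n%:R * p n) &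
     16 * 80 ^+ 2 <= Num.sqrt n%:R :> R], 1 <= ln n%:R :> R &
     1 - n%:R `^ (- 1) <= sbm_pr (p n) (q n) (@good_graph R n (p n) (q n) e)].
  by near: n; exact: good.
have dn : 2 <= d1 * n%:R.
  rewrite mulrC -ler_pdivrMr //.
  by near: n; exact: natr_large.
have N0 : 0 < n%:R :> R by rewrite ltr0n.
apply: le_trans hgood _; apply: le_sbm_pr => // E _ gE.
have [A [dA gA bA]] := biased_start n0 d10 d11 dn.
exists A; split => // d Omega P W HW.
have x0 : 0 < expR (e ^+ 2 / 16 * n%:R) by exact: expR_gt0.
have [m [mx ->]] := prob_Tcons_ge HW A x0.
rewrite lee_fin lerB //.
have gA' : g1 <= gamma A by apply: le_trans gA; lra.
apply: le_trans (trap_no_consensus e0 e2 _ D1 r_ge0 _ n0 gE d11 trap e18 m dA gA') _ => //.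
apply: le_trans (_ : expR (e ^+ 2 / 16 * n%:R) * (4 * expR (- (e ^+ 2 * n%:R / 8))) <= _).
  by rewrite ler_wpM2r ?mulr_ge0 ?expR_ge0 // ltW.
rewrite mulrCA -expRD powR_inv1 ?(ltW N0) //.
have -> : e ^+ 2 / 16 * n%:R - e ^+ 2 * n%:R / 8 = - (e ^+ 2 * n%:R / 16) by field.
have y0 : 0 < e ^+ 2 * n%:R / 16 by rewrite divr_gt0 // mulr_gt0.
apply: le_trans (ler_wpM2l (ler0n R 4) (expR_le_inv y0)) _.
by rewrite le_eqVlt; apply/orP; left; apply/eqP; field; rewrite !gt_eqF.
Unshelve. all: by end_near.
Qed.
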